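(* Let $d\ge2$, $a\in(0,\pi/2)$ and $\varepsilon\in(0,1]$. Then there are constants $c_6,c_7>0$, where $c_6$ depends on $a,d,\varepsilon$ and $c_7\ge0.3\cdot0.01^d\,a^{d-1}(\pi/2-a)^{d-1}$, such that for every $\gamma_s\in(0,\infty)$ the Crofton cell $Z_0$ of the hypersphere tessellation derived from an isotropic Poisson point process on $\mathbb{S}^d$ with intensity $\gamma_s$ satisfies $$\mathbb{P}\left(\vartheta_r(Z_0)\ge\varepsilon\mid\Sigma_r(Z_0)\ge a\right)\le c_6\exp\left(-c_7\,\varepsilon^{\frac{d+1}{2}}\,\gamma_s\right).$$
   Context: $\mathbb{S}^d$ is the unit sphere in $\mathbb{R}^{d+1}$ ($d\ge2$), $\sigma_d^\circ$ its normalized (probability) spherical Lebesgue measure, $B_s(x,r)$ the closed geodesic ball. $\overline{\mathcal{K}}^d_s$ is the set of spherically convex bodies, i.e. intersections of $\mathbb{S}^d$ with a closed convex cone in $\mathbb{R}^{d+1}$ that is not a linear subspace. For $K\in\overline{\mathcal{K}}^d_s$ and $e\in K$: $r_e(K)=\max\{r\ge0:B_s(e,r)\subset K\}$, $R_e(K)=\min\{r\ge0:K\subset B_s(e,r)\}$; $\Sigma_r(K)=\max\{r_e(K):e\in K\}$ (inradius) and $\vartheta_r(K)=\min\{R_e(K)-r_e(K):e\in K,\ r_e(K)=\Sigma_r(K)\}$. An isotropic Poisson point process $X$ with intensity $\gamma_s$ is a Poisson process on $\mathbb{S}^d$ with intensity measure $\gamma_s\sigma_d^\circ$. The associated hypersphere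 tessellation partitions $\mathbb{S}^d$ by the great hyperspheres $\mathbb{S}^d\cap x^\perp$, $x\in X$ (cells are closures of connected components of the complement of their union; if $X$ is empty the only cell is $\mathbb{S}^d$). Fix $\mathsf p\in\mathbb{S}^d$; the Crofton cell $Z_0$ is the almost surely unique cell containing $\mathsf p$ in its interior. Conventions: $\Sigma_r(\mathbb{S}^d)\ge a$ (the whole sphere contains balls of every radius), and the event $\{\vartheta_r(Z_0)\ge\varepsilon\}$ is understood to require $Z_0\in\overline{\mathcal{K}}^d_s$. *)

(* Defs.v *)
From HB Require Import structures.
From mathcomp Require Import all_boot all_order all_algebra.
From mathcomp Require Import all_classical all_reals all_analysis.
Set Implicit Arguments.
Unset Strict Implicit.
Unset Printing Implicit Defensive.
Import Order.TTheory GRing.Theory Num.Theory.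
Import numFieldNormedType.Exports.
Local Open Scope classical_set_scope.
Local Open Scope ring_scope.

Section Sphere.
Context {R : realType} {n : nat}.
Implicit Types (x y e : 'rV[R]_n) (A K C Z : set 'rV[R]_n) (X : seq 'rV[R]_n).

Definition dotp x y : R := \sum_(i < n) x 0 i * y 0 i.

(* The library norm on ['rV[R]_n] is the sup norm, hence [dotp]. *)
Definition sphere : set 'rV[R]_n := [set x | dotp x x = 1].

Definition geod_dist x y : R := acos (dotp x y).

Definition geod_ball x (r : R) : set 'rV[R]_n :=
  sphere `&` [set y | geod_dist x y <= r].

Definition borel A : Prop := (<<s [set U | open U] >>) A.

Definition closed_convex_cone C : Prop :=
  [/\ C !=set0, closed C, convex_set (C : set (convex_lmodType 'rV[R]_n)) &
      forall (t : R) x, 0 <= t -> C x -> C (t *: x)].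

Definition linear_subspace C : Prop :=
  exists V : {vspace 'rV[R]_n}, C = [set x | x \in V].

Definition spherically_convex_body K : Prop :=
  exists C, [/\ closed_convex_cone C, ~ linear_subspace C & K = sphere `&` C].

(* The radii below live in [\bar R]; where the maxima and minima exist, they
   are these suprema and infima.  For [K = sphere], every radius is admissible
   and [inradius_at K e = inradius K = +oo]. *)
Definition inradius_at K e : \bar R :=
  ereal_sup [set r%:E | r in [set r : R | 0 <= r /\ geod_ball e r `<=` K]].

Definition circumradius_at K e : \bar R :=
  ereal_inf [set r%:E | r in [set r : R | 0 <= r /\ K `<=` geod_ball e r]].

Definition inradius K : \bar R := ereal_sup [set inradius_at K e | e in K].

Definition vartheta_r K : \bar R :=
  ereal_inf [set (circumradius_at K e - inradius_at K e)%E
            | e in [set e | K e /\ inradius_at K e = inradius K]].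

Definition great_hypersphere x : set 'rV[R]_n :=
  sphere `&` [set y | dotp x y = 0].

Definition off_hyperspheres X : set 'rV[R]_n :=
  sphere `\` \bigcup_(x in [set` X]) great_hypersphere x.

Definition is_cell X Z : Prop :=
  exists2 x, off_hyperspheres X x &
    Z = closure (connected_component (off_hyperspheres X) x).

Definition sphere_interior Z : set 'rV[R]_n :=
  sphere `&` [set x | within sphere (nbhs x) Z].

(* [set0] when [p] lies on one of the hyperspheres. *)
Definition crofton_cell (p : 'rV[R]_n) X : set 'rV[R]_n :=
  xget set0 [set Z | is_cell X Z /\ sphere_interior Z p].

End Sphere.

(* Lebesgue measure on R^n (for Borel sets), as an iterated product with the
   one-dimensional Lebesgue measure; R^0 carries the unit mass at its point. *)
Fixpoint lebesgue_rV {R : realType} (n : nat) : set 'rV[R]_n -> \bar R :=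
  match n with
  | 0 => fun A => (\1_A (0 : 'rV[R]_0))%:E
  | m.+1 => fun A => (\int[@lebesgue_measure R]_t
      lebesgue_rV [set v : 'rV[R]_m | A (row_mx (t : R)%:M v)])%E
  end.

Section SphericalMeasure.
Context {R : realType} {n : nat}.

Definition cone_over (A : set 'rV[R]_n) : set 'rV[R]_n :=
  [set x | exists t u, [/\ 0 <= t <= 1, (A `&` sphere) u & x = t *: u]].

(* Polar coordinates: the surface measure is n times the volume of the part of
   the unit ball lying over [A]. *)
Definition spherical_measure (A : set 'rV[R]_n) : \bar R :=
  (n%:R%:E * lebesgue_rV (cone_over A))%E.

Definition normalized_spherical_measure (A : set 'rV[R]_n) : R :=
  fine (spherical_measure A) / fine (spherical_measure setT).

End SphericalMeasure.

Section PointProcess.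
Context {R : realType} {n : nat} {disp : measure_display}.
Context {T : measurableType disp}.
Implicit Types (P : probability T R) (X : T -> seq 'rV[R]_n).

(* A finite point configuration is encoded by an enumeration of its points,
   repeated according to multiplicity.  Only the counts are constrained to be
   measurable, so that the order of the enumeration is immaterial. *)
Definition num_points X (A : set 'rV[R]_n) (w : T) : nat :=
  count (fun x => x \in A) (X w).

Definition isotropic_poisson_process P (gamma : R) X : Prop :=
  [/\ forall w x, x \in X w -> sphere x,
      forall A, borel A -> measurable_fun [set: T] (num_points X A),
      (* the second argument of [poisson_prob] is a dummy *)
      forall A (U : set nat), borel A ->
        P (num_points X A @^-1` U) =
        poisson_prob (gamma * normalized_spherical_measure A) 0 U &
      forall (m : nat) (A : 'I_m -> set 'rV[R]_n) (U : 'I_m -> set nat),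
        (forall i, borel (A i)) -> trivIset setT A ->
        P (\bigcap_i (num_points X (A i) @^-1` U i)) =
        (\prod_(i < m) P (num_points X (A i) @^-1` U i))%E].

Definition cond_prob P (A B : set T) : R := fine (P (A `&` B)) / fine (P B).

End PointProcess.

(* Main.v *)
(* The incenter [e] of a cell with inradius at least [a] and radius difference
   at least [eps] has a point [y] of the cell at distance at least [a + eps].
   Hence no hypersphere of the process meets the open ball of radius [a] around
   [e], nor separates [e] from [y].  The hyperspheres meeting the ball have
   measure [Phi], whatever [e] is; those separating [y] from the ball contribute
   a further term of order [eps^((d+1)/2)], since around a suitable pole [u] in
   the plane of [e] and [y] their poles contain a box of size [eps] in one
   tangent direction and of size [sqrt eps] in the [d - 1] others.  The volume of
   this box is computed in coordinates adapted to [e] and [y]: the iterated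
   Lebesgue measure is invariant under reflections, because a translation
   invariant measure is determined by the volume of the unit ball.

   All these measures vary little when [e] and [y] move by [delta], so that a
   finite net of pairs [(e, y)] suffices, and the union bound gives the numerator
   up to the cardinality of the net.  The denominator is at least
   [exp (- gamma * Phi)], the probability that no hypersphere meets the ball of
   radius [a] around [p].  For this the two events must be shown measurable; they
   are expressed by maxima over the sphere of continuous functions of the
   configuration, which are determined by their values on a countable dense set. *)
Require Import Defs.
From HB Require Import structures.
From mathcomp Require Import all_boot all_order all_algebra.
From mathcomp Require Import all_classical all_reals all_analysis.
From mathcomp Require Import measurable_realfun.
From mathcomp Require Import ring lra.
Import Order.TTheory GRing.Theory Num.Theory.
Import numFieldNormedType.Exports.
Set Implicit Arguments.
Unset Strict Implicit.
Unset Printing Implicit Defensive.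
Local Open Scope classical_set_scope.
Local Open Scope ring_scope.

(** The term gamma * Phi must cancel exactly between numerator and denominator, so the passage to a
    net may cost only a fixed part of the additional term. Hence [delta] is chosen from a, d and eps
    alone, small enough for this cost; the net, and with it [c6], then does not depend on gamma. The
    size sqrt eps of the box comes from normalization: shifting a pole by r orthogonally to the
    plane of e and y leaves its dot products with e and y unchanged and alters its length only to
    order r^2, while a relative loss of order eps is affordable. Each hypersphere has two antipodal
    poles, so the box counts twice. Geometry enters through one function, [margin], the least signed
    dot product with the poles. The cell is the set where it is nonnegative, incenters are its
    maximizers, and a positive maximum is attained only once. This reduces the infimum in
    [vartheta_r] to a single term and makes both events inequalities between continuous
    functions. *)

(** * Borel sets of row vectors and iterated Lebesgue measure *)

(* Its measurable sets are, by conversion, those satisfying [borel]. *)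
Notation rVb R n := (g_sigma_algebraType [set U : set 'rV[R]_n | open U]).

Section BorelRowVectors.
Context {R : realType}.

Lemma borel_open n (A : set 'rV[R]_n) : open A -> borel A.
Proof. by move=> oA; exact: sub_sigma_algebra. Qed.

Lemma continuous_borel n (f : 'rV[R]_n -> R) :
  continuous f -> measurable_fun [set: rVb R n] f.
Proof.
move=> /continuousP cf.
apply: (measurability _ (RGenOpens.measurableE R)).
move=> _ [_ [a [b ->] <-]]; rewrite setTI; apply: borel_open.
by apply: cf; apply: interval_open.
Qed.

Lemma coord_borel n i : measurable_fun [set: rVb R n] (fun x => (x : 'rV[R]_n) 0 i).
Proof. by apply: continuous_borel; exact: coord_continuous. Qed.

Let box n (q : {ffun 'I_n -> rat}) (k : nat) : set 'rV[R]_n :=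
  [set x | forall i, `|x 0 i - ratr (q i)| < k.+1%:R^-1].

(** Reduces measurability into [rVb R n] to coordinates, see [measurable_rV]. Boxes that stick out
    of [U] are replaced by [set0], which keeps the index type countable and independent of [U]. *)
Let open_boxes n (U : set 'rV[R]_n) : open U ->
  U = \bigcup_(j : {ffun 'I_n -> rat} * nat)
       (if `[< box j.1 j.2 `<=` U >] then box j.1 j.2 else set0).
Proof.
move=> oU; apply/seteqP; split=> [x Ux|x [[q k] _ /=]]; last first.
  by case: asboolP => [+ xb|//]; exact.
have /nbhs_ballP[e /= e0 eU] := open_nbhs_nbhs (conj oU Ux).
pose k := Num.truncn (e / 2)^-1; have ke : k.+1%:R^-1 < e / 2.
  by rewrite -ltf_pV2 ?posrE ?divr_gt0// invrK truncnS_gt.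
have hq i : exists r : rat, `|x 0 i - ratr r| < k.+1%:R^-1.
  have [|r] := @rat_in_itvoo R (x 0 i - k.+1%:R^-1) (x 0 i + k.+1%:R^-1).
    by rewrite ltrD2l gtrN// invr_gt0.
  rewrite in_itv/= => /andP[h1 h2]; exists r.
  by rewrite ltr_distlC h1 h2.
exists ([ffun i => sval (cid (hq i))], k) => //=.
have xb : box [ffun i => sval (cid (hq i))] k x.
  by move=> i; rewrite ffunE; case: cid.
case: asboolP => [//|[]] y yb; apply: eU.
split=> // i j; rewrite ord1.
have := xb j; have := yb j; move: ([ffun _ => _] j) => r h1 h2.
rewrite -ball_normE/= (le_lt_trans (ler_distD (ratr r) _ _))//.
by rewrite [e]splitr ltrD// ?(lt_trans _ ke)// distrC.
Qed.

Lemma measurable_rV d (T : measurableType d) n (f : T -> 'rV[R]_n) :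
  (forall i, measurable_fun setT (fun w => f w 0 i)) ->
  measurable_fun setT (f : T -> rVb R n).
Proof.
move=> mf; apply: (@measurability _ _ T (rVb R n) setT f [set U : set 'rV[R]_n | open U]) => //.
move=> _ [U oU <-]; rewrite setTI (open_boxes oU) preimage_bigcup.
apply: countable_bigcupT_measurable; first exact: countableP.
move=> [q k] /=; case: asboolP => _; last by rewrite preimage_set0.
rewrite (_ : _ @^-1` _ = \bigcap_(i in [set: 'I_n])
   ((fun w => f w 0 i) @^-1` (ball (ratr (q i) : R) k.+1%:R^-1))); last first.
  apply/seteqP; split=> w /= h i => [_|].
    by rewrite -ball_normE/= distrC; exact: h.
  by have := h i I; rewrite -ball_normE /= distrC.
apply: fin_bigcap_measurable => // i _.
rewrite -[X in measurable X]setTI; apply: mf => //.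
exact: measurable_ball.
Qed.

End BorelRowVectors.

Section SigmaFiniteMeasure.
Context d (T : measurableType d) (R : realType).
Variables (m : {measure set T -> \bar R}) (sf : sigma_finite setT m).

Let nu : set T -> \bar R := m.

HB.instance Definition _ := Measure.on nu.
HB.instance Definition _ := Measure_isSigmaFinite.Build _ _ _ nu sf.

(** The local copy [nu] of [m] is the constant to which the sigma-finiteness structure is
    attached. *)
Lemma sigma_finite_measureP :
  exists nu : {sigma_finite_measure set T -> \bar R}, forall A, nu A = m A.
Proof. by exists nu. Qed.

End SigmaFiniteMeasure.

Section SigmaFinitePushforward.
Context d1 d2 (T1 : measurableType d1) (T2 : measurableType d2) (R : realType).
Variables (mu : {measure set T1 -> \bar R}) (phi : T1 -> T2) (psi : T2 -> T1).
Hypotheses (mphi : measurable_fun setT phi) (mpsi : measurable_fun setT psi).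
Hypothesis phiK : cancel phi psi.

Lemma sigma_finite_pushforward : sigma_finite setT mu ->
  exists nu : {sigma_finite_measure set T2 -> \bar R},
    forall A, nu A = mu (phi @^-1` A).
Proof.
move=> [F TF Foo].
pose m : {measure set T2 -> \bar R} := pushforward mu phi.
have sf : sigma_finite setT (m mphi).
  exists (fun i => psi @^-1` F i).
    by rewrite -preimage_bigcup -TF preimage_setT.
  move=> i; have [mF Fy] := Foo i; split.
    by rewrite -[X in measurable X]setTI; exact: mpsi.
  rewrite /m/= /pushforward (_ : _ @^-1` _ = F i) //.
  by apply/seteqP; split=> x /=; rewrite phiK.
have [nu nuE] := sigma_finite_measureP sf.
by exists nu => A; rewrite nuE.
Qed.

End SigmaFinitePushforward.

Lemma sigma_finite_product d1 d2 (T1 : measurableType d1)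
    (T2 : measurableType d2) (R : realType)
    (m1 : {sigma_finite_measure set T1 -> \bar R})
    (m2 : {sigma_finite_measure set T2 -> \bar R}) :
  sigma_finite setT (m1 \x m2)%E.
Proof.
have [F TF Foo] := sigma_finiteT m1; have [G TG Goo] := sigma_finiteT m2.
exists (fun n => let ij := odflt (0, 0)%N (unpickle n) in F ij.1 `*` G ij.2).
  apply/esym; rewrite -subTset => -[x y] _.
  have [i _ Fx] : (\bigcup_i F i) x by rewrite -TF.
  have [j _ Gy] : (\bigcup_i G i) y by rewrite -TG.
  by exists (pickle (i, j)); rewrite //= pickleK.
move=> k /=; set i := _.1; set j := _.2.
have [mF Fy] := Foo i; have [mG Gy] := Goo j.
by split; [exact: measurableX|rewrite product_measure1E// lte_mul_pinfty// ge0_fin_numE].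
Qed.

Section LebesgueRowVectors.
Context {R : realType}.
Local Open Scope ereal_scope.

(** The gluing in the recursive clause of [lebesgue_rV]. With its inverse it identifies R x R^n with
    R^(n+1), which turns the iterated integral into a product measure. *)
Definition consr n (tv : R * 'rV[R]_n) : 'rV[R]_n.+1 := row_mx (tv.1)%:M tv.2.

Lemma consr0 n tv : @consr n tv 0%R 0%R = tv.1.
Proof.
rewrite /consr; have -> : (0%R : 'I_n.+1) = lshift n (0%R : 'I_1) by apply/val_inj.
by rewrite [LHS]row_mxEl mxE eqxx mulr1n.
Qed.

Lemma consrS n tv i : @consr n tv 0%R (lift 0%R i) = tv.2 0%R i.
Proof.
rewrite /consr; have -> : lift (0%R : 'I_n.+1) i = rshift 1 i by apply/val_inj.
by rewrite [LHS]row_mxEr.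
Qed.

Definition tailr n (v : 'rV[R]_n.+1) : 'rV[R]_n := \row_i v 0%R (lift 0%R i).

Lemma consrK n : cancel (@consr n) (fun v : 'rV[R]_n.+1 => (v 0%R 0%R, tailr v)).
Proof.
move=> [t v]; rewrite consr0; congr (_, _).
by apply/rowP => i; rewrite mxE consrS.
Qed.

Lemma measurable_consr n :
  measurable_fun setT (@consr n : measurableTypeR R * rVb R n -> rVb R n.+1).
Proof.
apply: measurable_rV => i; case: (unliftP 0%R i) => [j ->|->].
  rewrite (_ : (fun w => _) = (fun v : rVb R n => (v : 'rV[R]_n) 0%R j) \o snd).
    exact: measurableT_comp (coord_borel _) measurable_snd.
  by apply/funext => w; exact: consrS.
rewrite (_ : (fun w => _) = fst); first exact: measurable_fst.
by apply/funext => w; exact: consr0.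
Qed.

Lemma measurable_unconsr n :
  measurable_fun setT ((fun v : 'rV[R]_n.+1 => (v 0%R 0%R, tailr v)) :
    rVb R n.+1 -> measurableTypeR R * rVb R n).
Proof.
apply: measurable_fun_pair; first exact: coord_borel.
apply: measurable_rV => i.
rewrite (_ : (fun w => _) = (fun v : rVb R n.+1 => (v : 'rV[R]_n.+1) 0%R (lift 0%R i))).
  exact: coord_borel.
by apply/funext => w; rewrite mxE.
Qed.

(** Inductively the measure is the pushforward under [consr] of the product of one-dimensional
    Lebesgue measure with the measure one dimension lower. Agreement is claimed on Borel sets only:
    their sections are Borel, so the induction hypothesis applies to them. *)
Lemma lebesgue_rV_sigma_finite n :
  exists mu : {sigma_finite_measure set (rVb R n) -> \bar R},
    forall A, borel A -> lebesgue_rV A = mu A.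
Proof.
elim: n => [|n [mu muE]].
  exists (@dirac _ (rVb R 0) (0%R : 'rV[R]_0) R) => A _ /=.
  by [].
have sf := sigma_finite_product (@lebesgue_measure R) mu.
have [nu nuE] := sigma_finite_pushforward
  (@measurable_consr n) (@measurable_unconsr n) (@consrK n) sf.
exists nu => A bA; rewrite nuE /= /product_measure1.
apply: eq_integral => t _ /=; rewrite muE.
  by congr (mu _); apply/seteqP; split=> v; rewrite /xsection/= in_setE.
have mA : measurable (consr (n:=n) @^-1` (A : set (rVb R n.+1))
    : set (measurableTypeR R * rVb R n)).
  by rewrite -[X in measurable X]setTI; exact: measurable_consr.
have := measurable_xsection t mA.
by rewrite (_ : xsection _ _ = [set v | A (row_mx (t : R)%:M v)])//;
  apply/seteqP; split=> v; rewrite /xsection/= in_setE.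
Qed.

Definition rVm n : {sigma_finite_measure set (rVb R n) -> \bar R} :=
  sval (cid (lebesgue_rV_sigma_finite n)).

Lemma rVmE n (A : set 'rV[R]_n) : borel A -> lebesgue_rV A = rVm n A.
Proof. exact: (svalP (cid (lebesgue_rV_sigma_finite n))). Qed.

End LebesgueRowVectors.

Lemma tonelli_sections d1 d2 (T1 : measurableType d1) (T2 : measurableType d2)
    (R : realType) (m1 : {sigma_finite_measure set T1 -> \bar R})
    (m2 : {sigma_finite_measure set T2 -> \bar R}) (E : set (T1 * T2)) :
  measurable E ->
  (\int[m1]_x m2 [set y | E (x, y)] = \int[m2]_y m1 [set x | E (x, y)])%E.
Proof.
move=> mE; have := indic_fubini_tonelli m1 m2 mE.
rewrite (indic_fubini_tonelli_FE _ mE) (indic_fubini_tonelli_GE _ mE).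
congr (_ = _); apply: eq_integral => z _ /=; congr (_ _);
  by apply/seteqP; split=> w; rewrite /xsection /ysection /= in_setE.
Qed.

Section Affine.
Context {R : realType}.
Local Open Scope ereal_scope.

(** The pushforward of Lebesgue measure under t |-> r t + c, scaled by r, agrees with Lebesgue
    measure on half-open intervals, hence everywhere. *)
Lemma integral_affine (f : R -> \bar R) (r c : R) : (0 < r)%R ->
  measurable_fun [set: measurableTypeR R] f -> (forall x, 0 <= f x) ->
  r%:E * \int[@lebesgue_measure R]_t f (r * t + c)%R = \int[@lebesgue_measure R]_t f t.
Proof.
move=> r0 mf f0; pose phi (t : measurableTypeR R) : measurableTypeR R := (r * t + c)%R.
have mphi : measurable_fun setT phi.
  by apply: measurable_funD => //; apply: measurable_funM.
pose m1 : {measure set (measurableTypeR R) -> \bar R} :=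
  pushforward (@lebesgue_measure R) phi.
pose k : {nonneg R} := NngNum (ltW r0).
rewrite [RHS](eq_measure_integral (mscale k (m1 mphi))); last first.
  move=> A mA _; apply: lebesgue_measure_unique => // X [[a b] _ <-].
  transitivity (r%:E * @lebesgue_measure R (phi @^-1` `]a, b]%classic)) => //.
  rewrite (_ : _ @^-1` _ = `](a - c) / r, (b - c) / r]%classic)%R; last first.
    apply/seteqP; split=> t; rewrite /= !in_itv/= /phi => /andP[h1 h2].
      by rewrite ltr_pdivrMr// ler_pdivlMr// ltrBlDr lerBrDr ![(t * r)%R]mulrC h1.
    by move: h1 h2; rewrite ltr_pdivrMr// ler_pdivlMr// ltrBlDr lerBrDr ![(t * r)%R]mulrC => ->.
  rewrite !lebesgue_measure_itv/= !lte_fin ltr_pM2r ?invr_gt0// ltrD2r.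
  case: ifPn => _; last by rewrite mule0.
  by rewrite -!EFinB -EFinM; congr EFin; field; rewrite gt_eqF.
rewrite ge0_integral_mscale// /= ge0_integral_pushforward//.
Qed.

Lemma measurable_dotp d (T : measurableType d) n (f g : T -> 'rV[R]_n) :
  measurable_fun setT (f : T -> rVb R n) -> measurable_fun setT (g : T -> rVb R n) ->
  measurable_fun setT (fun w => dotp (f w) (g w)).
Proof.
move=> mf mg; apply: measurable_sum => i; apply: measurable_funM.
  by apply: (measurableT_comp (@coord_borel R n i)).
by apply: (measurableT_comp (@coord_borel R n i)).
Qed.

Definition slice n (A : set 'rV[R]_n.+1) (t : R) : set 'rV[R]_n :=
  [set v | A (consr (t, v))].

Lemma measurable_slices n (A : set 'rV[R]_n.+1) : borel A ->
  measurable ((fun tv => A (consr tv)) : set (measurableTypeR R * rVb R n)).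
Proof.
move=> bA; rewrite -[X in measurable X]setTI.
exact: (@measurable_consr R n) measurableT _ bA.
Qed.

Lemma borel_slice n (A : set 'rV[R]_n.+1) t : borel A -> borel (slice A t).
Proof.
move=> /measurable_slices /(measurable_xsection t).
by congr measurable; apply/seteqP; split=> v; rewrite /xsection/= in_setE.
Qed.

Lemma measurable_rVm_slice n (A : set 'rV[R]_n.+1) : borel A ->
  measurable_fun [set: measurableTypeR R] (fun t => rVm n (slice A t)).
Proof.
move=> /measurable_slices /(measurable_fun_xsection (rVm n)).
congr measurable_fun; apply/funext => t /=; congr (rVm n _).
by apply/seteqP; split=> v; rewrite /xsection/= in_setE.
Qed.

Lemma rVmS n (A : set 'rV[R]_n.+1) : borel A ->
  rVm n.+1 A = \int[@lebesgue_measure R]_t rVm n (slice A t).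
Proof.
move=> bA; rewrite -rVmE//; apply: eq_integral => t _; rewrite -rVmE//.
exact: borel_slice.
Qed.

Lemma measurable_affine n (r : R) (c : 'rV[R]_n) :
  measurable_fun setT ((fun x => r *: x + c)%R : rVb R n -> rVb R n).
Proof.
apply: measurable_rV => i.
rewrite (_ : (fun w => _) =
    (fun w : rVb R n => r * (w : 'rV[R]_n) 0 i + c 0 i)%R); last first.
  by apply/funext => w; rewrite !mxE.
by apply: measurable_funD => //; apply: measurable_funM => //; exact: coord_borel.
Qed.

Lemma borel_preimage m n (f : 'rV[R]_m -> 'rV[R]_n) A :
  measurable_fun setT (f : rVb R m -> rVb R n) -> borel A -> borel (f @^-1` A).
Proof. by move=> mf bA; have := mf measurableT _ bA; rewrite setTI. Qed.

Lemma rVm_affine n (r : R) (c : 'rV[R]_n) (A : set 'rV[R]_n) : (0 < r)%R ->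
  borel A ->
  (r ^+ n)%:E * rVm n [set x | A (r *: x + c)%R] = rVm n A.
Proof.
move=> r0; elim: n => [|n IH] in c A *.
  move=> bA; rewrite expr0 mul1e; congr (rVm 0 _).
  by apply/seteqP; split=> x /=; rewrite (_ : (r *: x + c)%R = x)//; apply/rowP => -[].
move=> bA; have bA' : borel [set x | A (r *: x + c)%R].
  exact: (borel_preimage (measurable_affine r c)).
have sl t : slice [set x | A (r *: x + c)%R] t =
    [set v | slice A (r * t + c 0%R 0%R)%R (r *: v + tailr c)%R].
  rewrite /slice/=; apply/funext => v; congr (A _).
  apply/rowP => i; case: (unliftP 0%R i) => [j ->|->].
    by rewrite consrS [LHS]mxE [X in (X + _)%R]mxE consrS !mxE.
  by rewrite consr0 [LHS]mxE [X in (X + _)%R]mxE consr0.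
have rn0 : (0 < r ^+ n)%R by rewrite exprn_gt0.
rewrite rVmS// (rVmS bA).
rewrite -(@integral_affine (fun t => rVm n (slice A t)) r (c 0%R 0%R))//; last first.
  exact: measurable_rVm_slice.
rewrite exprS EFinM -muleA; congr (_ * _).
rewrite -ge0_integralZl//; last 2 first.
- exact: measurable_rVm_slice.
- by rewrite lee_fin ltW.
by apply: eq_integral => t _; rewrite sl IH//; exact: borel_slice.
Qed.

End Affine.

(** * Uniqueness of translation-invariant measures and reflections *)

Section HaarUniqueness.
Context {R : realType} {n : nat}.
Local Open Scope ereal_scope.

Definition translation_invariant (m : set 'rV[R]_n -> \bar R) :=
  forall c A, borel A -> m [set x | A (x + c)%R] = m A.

Lemma measurable_translate (c : 'rV[R]_n) (A : set 'rV[R]_n) :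
  borel A -> borel [set x | A (x + c)%R].
Proof.
move=> bA; have := borel_preimage (measurable_affine 1 c) bA.
by congr borel; apply/funext => x; rewrite /preimage /= scale1r.
Qed.

(** The two parameters cover x, x + y and x - y at once, the maps that occur in [haar_unique]. *)
Lemma measurable_shear (s t : R) (A : set 'rV[R]_n) : borel A ->
  measurable ((fun xy => A (s *: xy.1 + t *: xy.2)%R) : set (rVb R n * rVb R n)).
Proof.
move=> bA.
suff mf : measurable_fun setT
    ((fun xy : 'rV[R]_n * 'rV[R]_n => (s *: xy.1 + t *: xy.2)%R) :
       rVb R n * rVb R n -> rVb R n).
  by rewrite -[X in measurable X]setTI; exact: mf.
apply: measurable_rV => i.
rewrite (_ : (fun w => _) = (fun w : rVb R n * rVb R n =>
    s * (w.1 : 'rV[R]_n) 0 i + t * (w.2 : 'rV[R]_n) 0 i)%R); last first.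
  by apply/funext => w; rewrite !mxE.
by apply: measurable_funD; apply: measurable_funM => //;
  apply: (measurableT_comp (@coord_borel R n i)).
Qed.

(* Both sides are the [mu \x nu]-measure of [{(x, y) | B x /\ A (x + y)}],
   computed by slicing along [y] and along [x] respectively. *)
Lemma haar_unique (mu nu : {sigma_finite_measure set (rVb R n) -> \bar R})
    (A B : set 'rV[R]_n) :
  translation_invariant mu -> translation_invariant nu ->
  borel A -> borel B -> (forall x, B (- x)%R <-> B x) ->
  mu B * nu A = mu A * nu B.
Proof.
move=> tmu tnu bA bB symB.
have mA := @measurable_shear 1 1 A bA; have mB := @measurable_shear 1 (-1) B bB.
have mA1 := @measurable_shear 1 0 A bA; have mB1 := @measurable_shear 1 0 B bB.
have scale (x y : 'rV[R]_n) : ((1 *: x + 1 *: y) = x + y)%R by rewrite !scale1r.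
have scaleB (x y : 'rV[R]_n) : ((1 *: x + -1 *: y) = x - y)%R.
  by rewrite scale1r scaleN1r.
have scale0 (x y : 'rV[R]_n) : ((1 *: x + 0 *: y) = x)%R.
  by rewrite scale1r scale0r addr0.
have := tonelli_sections mu nu (measurableI _ _ mB1 mA).
have := tonelli_sections mu nu (measurableI _ _ mA1 mB).
pose I (C D : set 'rV[R]_n) (m m' : set (rVb R n) -> \bar R) :=
  \int[m]_x ((\1_C x)%:E * m' D).
have IE (m m' : {sigma_finite_measure set (rVb R n) -> \bar R}) (C D : set 'rV[R]_n) :
    borel C -> \int[m]_x ((\1_C x)%:E * m' D) = m C * m' D.
  move=> bC; rewrite ge0_integralZr//.
    by rewrite integral_indic// setIT.
  exact/measurable_EFinP/measurable_indic.
have -> : \int[mu]_x nu [set y | ((fun xy => A (1 *: xy.1 + 0 *: xy.2)%R)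
     `&` (fun xy => B (1 *: xy.1 + -1 *: xy.2)%R)) (x, y)] = mu A * nu B.
  rewrite -IE//; apply: eq_integral => x _; rewrite indicE.
  case: (boolP (x \in A)) => [/set_mem Ax|/negP Ax].
    rewrite mul1e -[RHS](tnu (- x)%R)//; congr (nu _); apply/seteqP; split=> y /=.
      by rewrite scale0 scaleB => -[_ /symB]; rewrite opprB.
    by rewrite scale0 scaleB => /symB; rewrite opprB.
  rewrite mul0e -(measure0 nu); congr (nu _); apply/seteqP; split=> y //=.
  by rewrite scale0 => -[/mem_set].
have -> : \int[mu]_x nu [set y | ((fun xy => B (1 *: xy.1 + 0 *: xy.2)%R)
     `&` (fun xy => A (1 *: xy.1 + 1 *: xy.2)%R)) (x, y)] = mu B * nu A.
  rewrite -IE//; apply: eq_integral => x _; rewrite indicE.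
  case: (boolP (x \in B)) => [/set_mem Bx|/negP Bx].
    rewrite mul1e -[RHS](tnu x)//; congr (nu _); apply/seteqP; split=> y /=.
      by rewrite scale0 scale (addrC x) => -[].
    by rewrite scale0 scale (addrC x); split.
  rewrite mul0e -(measure0 nu); congr (nu _); apply/seteqP; split=> y //=.
  by rewrite scale0 => -[/mem_set].
move=> -> ->; apply: eq_integral => y _.
pose E := [set x : 'rV[R]_n | B x /\ A (x + y)%R].
have bE : borel E.
  exact: (@measurableI _ (rVb R n) _ _ bB (measurable_translate y bA)).
transitivity (mu E).
  by congr (mu _); apply/funext => x /=; rewrite /setI /= scale0 scale.
rewrite -[LHS](tmu (- y)%R)//; congr (mu _); apply/seteqP; split => x;
  by rewrite /E /= scale0 scaleB subrK => -[].
Qed.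

End HaarUniqueness.

(** * Dot product, reflections and volumes of balls and cubes *)

Section DotProduct.
Context {R : realType} {n : nat}.
Implicit Types x y z u v w : 'rV[R]_n.

Lemma dotpC x y : dotp x y = dotp y x.
Proof. by apply: eq_bigr => i _; rewrite mulrC. Qed.

Lemma dotpDl x y z : dotp (x + y) z = dotp x z + dotp y z.
Proof. by rewrite -big_split; apply: eq_bigr => i _; rewrite mxE mulrDl. Qed.

Lemma dotpZl t x y : dotp (t *: x) y = t * dotp x y.
Proof. by rewrite mulr_sumr; apply: eq_bigr => i _; rewrite mxE mulrA. Qed.

Lemma dotpDr x y z : dotp x (y + z) = dotp x y + dotp x z.
Proof. by rewrite dotpC dotpDl !(dotpC x). Qed.

Lemma dotpZr t x y : dotp x (t *: y) = t * dotp x y.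
Proof. by rewrite dotpC dotpZl (dotpC x). Qed.

Lemma dotpNl x y : dotp (- x) y = - dotp x y.
Proof. by rewrite -scaleN1r dotpZl mulN1r. Qed.

Lemma dotpNr x y : dotp x (- y) = - dotp x y.
Proof. by rewrite dotpC dotpNl dotpC. Qed.

Lemma dotpBl x y z : dotp (x - y) z = dotp x z - dotp y z.
Proof. by rewrite dotpDl dotpNl. Qed.

Lemma dotpBr x y z : dotp x (y - z) = dotp x y - dotp x z.
Proof. by rewrite dotpDr dotpNr. Qed.

Lemma dotp0l x : dotp 0 x = 0.
Proof. by rewrite -(scale0r 0) dotpZl mul0r. Qed.

Lemma dotp0r x : dotp x 0 = 0.
Proof. by rewrite dotpC dotp0l. Qed.

Definition dotpE := (dotpDl, dotpDr, dotpNl, dotpNr, dotpZl, dotpZr).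

Lemma dotp_ge0 x : 0 <= dotp x x.
Proof. by apply: sumr_ge0 => i _; rewrite -expr2 sqr_ge0. Qed.

Lemma dotp_eq0 x : (dotp x x == 0) = (x == 0).
Proof.
apply/eqP/eqP => [/eqP|->]; last by rewrite dotp0l.
rewrite psumr_eq0 => [/allP h|i _]; last by rewrite -expr2 sqr_ge0.
apply/rowP => i; rewrite mxE; apply/eqP.
by have := h i; rewrite mem_index_enum mulf_eq0 orbb => /(_ isT).
Qed.

Lemma dotp_gt0 x : x != 0 -> 0 < dotp x x.
Proof. by move=> x0; rewrite lt_neqAle dotp_ge0 eq_sym dotp_eq0 x0. Qed.

(** For w = 0 this is the identity, so w = u - v may be used even when u = v. *)
Definition reflection w x : 'rV[R]_n := x - (2 * dotp x w / dotp w w) *: w.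

Lemma reflectionK w : involutive (reflection w).
Proof.
move=> x; have [->|w0] := eqVneq w 0; first by rewrite /reflection !scaler0 !subr0.
have ww : dotp w w != 0 by rewrite dotp_eq0.
rewrite /reflection dotpBl dotpZl; set c := 2 * dotp x w / dotp w w.
rewrite (_ : 2 * _ / _ = - c) ?scaleNr ?opprK ?subrK//.
by rewrite /c; field.
Qed.

Lemma dotp_reflection w x y : dotp (reflection w x) (reflection w y) = dotp x y.
Proof.
have [->|w0] := eqVneq w 0; first by rewrite /reflection !scaler0 !subr0.
have ww : dotp w w != 0 by rewrite dotp_eq0.
by rewrite /reflection !dotpE (dotpC w y); field.
Qed.

Lemma reflectionD w x y : reflection w (x + y) = reflection w x + reflection w y.
Proof. by rewrite /reflection dotpDl mulrDr mulrDl scalerDl opprD addrACA. Qed.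

Lemma reflectionZ w t x : reflection w (t *: x) = t *: reflection w x.
Proof.
by rewrite /reflection dotpZl scalerBr scalerA; congr (_ - _ *: _); ring.
Qed.

Lemma reflection_id w x : dotp x w = 0 -> reflection w x = x.
Proof. by rewrite /reflection => ->; rewrite mulr0 mul0r scale0r subr0. Qed.

(** Takes the place of rotations: every change of position below is one reflection or a product of
    two. *)
Lemma reflection_swap u v : dotp u u = dotp v v -> reflection (u - v) u = v.
Proof.
move=> uv; have [->|w0] := eqVneq u v.
  by rewrite subrr /reflection scaler0 subr0.
have ww : dotp (u - v) (u - v) != 0 by rewrite dotp_eq0 subr_eq0.
rewrite /reflection (_ : 2 * _ / _ = 1) ?scale1r ?subKr//.
have -> : 2 * dotp u (u - v) = dotp (u - v) (u - v).
  by rewrite !dotpE (dotpC v u) -uv; ring.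
by rewrite divff.
Qed.

Lemma measurable_reflection w :
  measurable_fun setT (reflection w : rVb R n -> rVb R n).
Proof.
apply: measurable_rV => i.
rewrite (_ : (fun x => _) = (fun x : rVb R n =>
    (x : 'rV[R]_n) 0 i - 2 * dotp x w / dotp w w * w 0 i)); last first.
  by apply/funext => x; rewrite !mxE.
apply: measurable_funB; first exact: coord_borel.
by do !apply: measurable_funM => //; apply: measurable_dotp.
Qed.

End DotProduct.

Section Volumes.
Context {R : realType}.

Lemma borel_le n (f g : 'rV[R]_n -> R) : measurable_fun [set: rVb R n] f ->
  measurable_fun [set: rVb R n] g -> borel [set x | f x <= g x].
Proof.
by move=> mf mg; have := measurable_fun_le measurableT mf mg; rewrite setTI.
Qed.

Lemma borel_lt n (f g : 'rV[R]_n -> R) : measurable_fun [set: rVb R n] f ->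
  measurable_fun [set: rVb R n] g -> borel [set x | f x < g x].
Proof.
move=> mf mg; have := @measurableC _ (rVb R n) _ (borel_le mg mf).
by congr borel; apply/seteqP; split=> x /=; rewrite ltNge => /negP.
Qed.

Definition unit_ball n : set 'rV[R]_n := [set x | dotp x x <= 1].

Lemma borel_unit_ball n : borel (@unit_ball n).
Proof. by apply: borel_le => //; exact: measurable_dotp. Qed.

Lemma translation_invariant_rVm n : translation_invariant (@rVm R n).
Proof.
move=> c A bA; rewrite -(rVm_affine c (ltr01) bA) expr1n mul1e.
by congr (rVm n _); apply/seteqP; split=> x /=; rewrite scale1r.
Qed.

Lemma rVm_prod n (I : set R) (B : set 'rV[R]_n) :
  measurable (I : set (measurableTypeR R)) -> borel B ->
  rVm n.+1 [set x : 'rV[R]_n.+1 | I (x 0 0) /\ B (tailr x)] = (lebesgue_measure I * rVm n B)%E.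
Proof.
move=> mI bB; have bE : borel [set x : 'rV[R]_n.+1 | I (x 0 0) /\ B (tailr x)].
  have := @measurable_unconsr R n measurableT _
    (@measurableX _ _ (measurableTypeR R) (rVb R n) _ _ mI bB).
  by rewrite setTI.
have sl t v : (I ((consr (t, v) : 'rV[R]_n.+1) 0 0) /\ B (tailr (consr (t, v)))) =
    (I t /\ B v) by have [-> ->] := consrK (t, v).
rewrite rVmS// (eq_integral (fun t : measurableTypeR R => (\1_I t)%:E * rVm n B)%E).
  rewrite ge0_integralZr//; first by rewrite integral_indic// setIT.
  exact/measurable_EFinP/measurable_indic.
move=> t _; rewrite indicE; case: (boolP (t \in I)) => [/set_mem It|/negP It].
  rewrite mul1e; congr (rVm n _); apply/seteqP; split=> v; rewrite /slice/= sl//.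
  by case.
rewrite mul0e -(measure0 (rVm n)); congr (rVm n _); apply/seteqP; split=> v //.
by rewrite /slice/= sl => -[/mem_set].
Qed.

Definition cube n (s : R) : set 'rV[R]_n := [set x | forall i, `|x 0 i| <= s].

Lemma cubeS n s : @cube n.+1 s =
  [set x : 'rV[R]_n.+1 | `[- s, s]%classic (x 0 0) /\ cube s (tailr x)].
Proof.
apply/seteqP; split=> x /=.
  move=> h; split; first by rewrite in_itv/= -ler_norml.
  by move=> i; rewrite mxE.
rewrite in_itv/= -ler_norml => -[h0 h1] i.
case: (unliftP 0 i) => [j ->|->//].
by have := h1 j; rewrite mxE.
Qed.

Lemma borel_cube n s : borel (@cube n s).
Proof.
rewrite (_ : cube s = \bigcap_(i in [set: 'I_n]) [set x | `|x 0 i| <= s]).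
  apply: (@fin_bigcap_measurable _ (rVb R n)) => // i _.
  by apply: borel_le => //; apply: measurableT_comp => //; exact: coord_borel.
by apply/seteqP; split=> x /= h i => [_|]; apply: h.
Qed.

Lemma rVm_cube n s : 0 < s -> rVm n (cube s) = ((2 * s) ^+ n)%:E.
Proof.
move=> s0; elim: n => [|n IH].
  rewrite -rVmE; last exact: borel_cube.
  by rewrite /= indicE mem_set//= => -[].
rewrite cubeS rVm_prod//; last exact: borel_cube.
rewrite IH lebesgue_measure_itv/= lte_fin (_ : - s < s) ?gtrN//.
by rewrite -EFinB -EFinM exprS; congr (_ * _)%:E; ring.
Qed.

(** The ball lies between the cubes of half-side 1/(n+1) and 1; taking n+1 instead of n includes
    dimension 0. Both bounds are needed to cancel this volume in [rVm_reflection]. *)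
Lemma rVm_unit_ball n : (0 < rVm n (@unit_ball n) < +oo)%E.
Proof.
apply/andP; split.
  have s0 : 0 < n.+1%:R^-1 :> R by rewrite invr_gt0.
  apply: (@lt_le_trans _ _ (rVm n (cube n.+1%:R^-1))).
    by rewrite rVm_cube// lte_fin exprn_gt0// mulr_gt0.
  apply: le_measure; rewrite ?inE; [exact: borel_cube|exact: borel_unit_ball|].
  move=> x h; apply: (@le_trans _ _ (\sum_(i < n) n.+1%:R^-1)).
    apply: ler_sum => i _; rewrite (le_trans (ler_norm _))// normrM.
    rewrite (le_trans (ler_pM _ _ (h i) (h i)))// ler_piMr ?(ltW s0)//.
    by rewrite invf_le1// ler1n.
  rewrite sumr_const card_ord -[_ *+ n]mulr_natl.
  by rewrite ler_pdivrMr// mul1r ler_nat.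
apply: (@le_lt_trans _ _ (rVm n (cube 1))); last by rewrite rVm_cube// ltry.
apply: le_measure; rewrite ?inE; [exact: borel_unit_ball|exact: borel_cube|].
move=> x h i; rewrite -(@ler_pXn2r _ 2)// ?nnegrE// expr1n real_normK ?num_real//.
rewrite (le_trans _ h)// /dotp (bigD1 i)//= -expr2 lerDl.
by apply: sumr_ge0 => j _; rewrite -expr2 sqr_ge0.
Qed.

Lemma rVm_reflection n w (A : set 'rV[R]_n) : borel A ->
  rVm n (reflection w @^-1` A) = rVm n A.
Proof.
move=> bA; have mw := measurable_reflection w.
have [nu nuE] := sigma_finite_pushforward mw mw (reflectionK w) (sigma_finiteT (rVm n)).
have tnu : translation_invariant nu.
  move=> c C bC; rewrite !nuE -[RHS](@translation_invariant_rVm n (reflection w c)).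
    congr (rVm n _); apply/seteqP; split=> x;
      by rewrite /preimage/= reflectionD reflectionK.
  exact: borel_preimage mw bC.
have := haar_unique (translation_invariant_rVm (n:=n)) tnu bA (@borel_unit_ball n).
rewrite !nuE (_ : reflection w @^-1` unit_ball (n:=n) = unit_ball (n:=n)); last first.
  by apply/funext => x; rewrite /preimage/unit_ball/= dotp_reflection.
have /andP[b0 boo] := rVm_unit_ball n.
have fb : rVm n (@unit_ball n) \is a fin_num by rewrite ge0_fin_numE// ltW.
have symb (x : 'rV[R]_n) : unit_ball (- x) <-> unit_ball x.
  by rewrite /unit_ball/= dotpNl dotpNr opprK.
move=> /(_ symb)/eqP; rewrite muleC eq_le !(lee_pmul2r fb b0) -eq_le.
by move/eqP.
Qed.

End Volumes.

(** * Normalized spherical measure *)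

Section Normalize.
Context {R : realType} {n : nat}.
Implicit Types x y : 'rV[R]_n.

Definition unitv x : 'rV[R]_n := (Num.sqrt (dotp x x))^-1 *: x.

Lemma sqrt_dotp_gt0 x : x != 0 -> 0 < Num.sqrt (dotp x x).
Proof. by move=> x0; rewrite sqrtr_gt0 dotp_gt0. Qed.

Lemma sqr_sqrt_dotp x : Num.sqrt (dotp x x) ^+ 2 = dotp x x.
Proof. by rewrite sqr_sqrtr// dotp_ge0. Qed.

Lemma sphere_unitv x : x != 0 -> sphere (unitv x).
Proof.
move=> x0; rewrite /sphere/= !dotpE -{3}sqr_sqrt_dotp.
by have := sqrt_dotp_gt0 x0 => s0; field; rewrite gt_eqF.
Qed.

Lemma sphere_neq0 x : sphere x -> x != 0.
Proof. by rewrite /sphere/= => h; rewrite -dotp_eq0 h oner_neq0. Qed.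

Lemma unitvZ t x : 0 < t -> sphere x -> unitv (t *: x) = x.
Proof.
move=> t0 sx; rewrite /unitv !dotpE sx mulr1 -expr2 sqrtr_sqr gtr0_norm//.
by rewrite scalerA mulVf ?scale1r// gt_eqF.
Qed.

Lemma unitv_id x : sphere x -> unitv x = x.
Proof. by move=> sx; rewrite -{1}[x]scale1r unitvZ. Qed.

Lemma unitvE x : x = Num.sqrt (dotp x x) *: unitv x.
Proof.
have [->|x0] := eqVneq x 0; first by rewrite /unitv !scaler0.
by rewrite /unitv scalerA divff ?scale1r// gt_eqF// sqrt_dotp_gt0.
Qed.

Lemma measurable_unitv : measurable_fun setT (unitv : rVb R n -> rVb R n).
Proof.
apply: measurable_rV => i.
(* The inverse square root is written as a real power, which is measurable on the whole line, so the
   origin is no special case. *)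
rewrite (_ : (fun x => _) = (fun x : rVb R n =>
    (dotp (x : 'rV[R]_n) x) `^ (- 2^-1) * (x : 'rV[R]_n) 0 i)); last first.
  by apply/funext => x; rewrite !mxE powRN powR12_sqrt// dotp_ge0.
apply: measurable_funM; last exact: coord_borel.
apply: (measurableT_comp (measurable_powR _)).
exact: measurable_dotp.
Qed.

Lemma reflection_unitv w x : reflection w (unitv x) = unitv (reflection w x).
Proof. by rewrite /unitv dotp_reflection reflectionZ. Qed.

End Normalize.

Section SphericalMeasureTheory.
Context {R : realType} {m : nat}.
Local Notation n := m.+1.
Implicit Types A B : set 'rV[R]_n.

(* [cone_over A] without its apex. *)
Definition open_cone A : set 'rV[R]_n :=
  [set x | 0 < dotp x x] `&` unit_ball (n:=n) `&` unitv @^-1` A.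

Lemma borel_open_cone A : borel A -> borel (open_cone A).
Proof.
move=> bA; apply: (@measurableI _ (rVb R n)); last first.
  exact: borel_preimage measurable_unitv bA.
apply: (@measurableI _ (rVb R n)); last exact: borel_unit_ball.
by apply: borel_lt => //; exact: measurable_dotp.
Qed.

Lemma borel_set0v : borel [set (0 : 'rV[R]_n)].
Proof.
have : borel [set x : 'rV[R]_n | dotp x x <= 0].
  by apply: borel_le => //; exact: measurable_dotp.
congr borel; apply/seteqP; split=> x /=; last by move=> ->; rewrite dotp0l.
by move=> h; apply/eqP; rewrite -dotp_eq0 eq_le h dotp_ge0.
Qed.

Lemma rVm_set0v : rVm n [set (0 : 'rV[R]_n)] = 0%E.
Proof.
apply/eqP; rewrite eq_le measure_ge0 andbT.
have bs : borel (@setT 'rV[R]_m) by exact: (@measurableT _ (rVb R m)).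
have := @rVm_prod R m [set 0] setT (measurable_set1 0) bs.
rewrite lebesgue_measure_set1 mul0e => <-.
apply: le_measure; rewrite ?inE; first exact: borel_set0v.
  have := @measurable_unconsr R m measurableT _
    (@measurableX _ _ (measurableTypeR R) (rVb R m) _ _ (measurable_set1 0) bs).
  by rewrite setTI.
by move=> x ->; split => //=; rewrite mxE.
Qed.

Lemma cone_overE A : open_cone A `<=` cone_over A /\
  cone_over A `<=` open_cone A `|` [set 0].
Proof.
split=> x; rewrite /cone_over /open_cone /=.
  move=> [[x0 x1] Ax]; exists (Num.sqrt (dotp x x)), (unitv x).
  have xn0 : x != 0 by rewrite -dotp_eq0 gt_eqF.
  split; [|by split=> //; exact: sphere_unitv|exact: unitvE].
  by rewrite sqrtr_ge0/= -sqrtr1 ler_sqrt.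
move=> [t [u [/andP[t0 t1] [Au su] ->]]].
move: t0; rewrite le_eqVlt => /predU1P[<-|t0]; first by right; rewrite scale0r.
left; rewrite /preimage /= unitvZ// /unit_ball/= !dotpE su mulr1.
by split=> //; split; [rewrite mulr_gt0|rewrite -expr2 exprn_ile1 ?(ltW t0)].
Qed.

(** [cone_over A] contains the origin exactly when [A] meets the sphere; in either case neither
    measurability nor volume is affected. *)
Lemma borel_setU_apex A B : borel A -> A `<=` B -> B `<=` A `|` [set 0] ->
  borel B /\ rVm n B = rVm n A.
Proof.
move=> bA AB BA.
have bU : borel (A `|` [set 0]).
  by apply: (@measurableU _ (rVb R n)) => //; exact: borel_set0v.
have bB : borel B.
  have [B0|B0] := pselect (B 0).
    by rewrite (_ : B = A `|` [set 0])//; apply/seteqP; split=> // x [/AB//|->].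
  by rewrite (_ : B = A)//; apply/seteqP; split=> // x Bx; have [//|x0] := BA x Bx;
    move: Bx; rewrite x0.
split=> //; apply/eqP; rewrite eq_le; apply/andP; split; last first.
  by apply: le_measure; rewrite ?inE.
apply: (@le_trans _ _ (rVm n (A `|` [set 0]))).
  by apply: le_measure; rewrite ?inE.
rewrite (le_trans (@measureU2 _ (rVb R n) _ _ _ _ bA borel_set0v))//.
by rewrite [X in (_ + X)%E](_ : _ = 0%E) ?adde0//; exact: rVm_set0v.
Qed.

(** The index is shifted: [ball_volume R m] belongs to the unit ball of R^(m+1). *)
Definition ball_volume : R := fine (rVm n (@unit_ball R n)).

Lemma ball_volume_gt0 : 0 < ball_volume.
Proof. by rewrite fine_gt0// rVm_unit_ball. Qed.

Lemma rVm_unit_ballE : rVm n (@unit_ball R n) = ball_volume%:E.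
Proof.
have /andP[b0 boo] := rVm_unit_ball (R:=R) n.
by rewrite /ball_volume fineK// ge0_fin_numE// ltW.
Qed.

Lemma rVm_open_cone_fin A : borel A -> rVm n (open_cone A) \is a fin_num.
Proof.
move=> bA; rewrite ge0_fin_numE//; apply: (@le_lt_trans _ _ (rVm n (@unit_ball R n))).
  apply: le_measure; rewrite ?inE; [exact: borel_open_cone|exact: borel_unit_ball|].
  by move=> x [[]].
by rewrite rVm_unit_ballE ltry.
Qed.

Lemma nsmE A : borel A -> normalized_spherical_measure A =
  fine (rVm n (open_cone A)) / ball_volume.
Proof.
move=> bA; rewrite /normalized_spherical_measure /spherical_measure.
have cone C : borel C -> lebesgue_rV (cone_over C) = rVm n (open_cone C).
  move=> bC; have [h1 h2] := cone_overE C.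
  have [b e] := borel_setU_apex (borel_open_cone bC) h1 h2.
  by rewrite rVmE.
have bT : borel (@setT 'rV[R]_n) by exact: (@measurableT _ (rVb R n)).
rewrite !cone// (_ : rVm n (open_cone setT) = ball_volume%:E); last first.
  rewrite -rVm_unit_ballE.
  have [|||_ ->//] := @borel_setU_apex (open_cone setT) (@unit_ball R n).
  - exact: borel_open_cone.
  - by move=> x [[]].
  - move=> x xb; have [->|x0] := eqVneq x 0; [by right|left].
    by split=> //; split=> //=; rewrite dotp_gt0.
rewrite fineM// ?rVm_open_cone_fin//= -mulf_div divff ?mul1r//.
Qed.

Lemma nsm_ge0 A : borel A -> 0 <= normalized_spherical_measure A.
Proof.
by move=> bA; rewrite nsmE// divr_ge0 ?fine_ge0// ltW// ball_volume_gt0.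
Qed.

Lemma nsm_le A B : borel A -> borel B -> A `&` sphere `<=` B ->
  normalized_spherical_measure A <= normalized_spherical_measure B.
Proof.
move=> bA bB AB; rewrite !nsmE// ler_pM2r ?invr_gt0 ?ball_volume_gt0//.
rewrite fine_le ?rVm_open_cone_fin// //.
apply: le_measure; rewrite ?inE; [exact: borel_open_cone|exact: borel_open_cone|].
move=> x [[x0 x1] Ax]; split=> //=; apply: AB; split=> //.
by apply: sphere_unitv; rewrite -dotp_eq0 gt_eqF.
Qed.

Lemma nsmU A B : borel A -> borel B -> (forall x, sphere x -> A x -> B x -> False) ->
  normalized_spherical_measure (A `|` B) =
  normalized_spherical_measure A + normalized_spherical_measure B.
Proof.
move=> bA bB AB; have bU := @measurableU _ (rVb R n) _ _ bA bB.
rewrite !nsmE// -mulrDl -fineD ?rVm_open_cone_fin//; congr (fine _ / _).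
have bcA := borel_open_cone bA; have bcB := borel_open_cone bB.
rewrite -measureU//; last first.
  apply/seteqP; split=> // x [[[x0 _] Ax] [_ Bx]].
  by apply: (AB (unitv x)) => //; apply: sphere_unitv; rewrite -dotp_eq0 gt_eqF.
congr (rVm _ _); apply/seteqP; split=> x; rewrite /open_cone/preimage/=.
  by move=> [h [h'|h']]; [left|right].
by move=> [[h h']|[h h']]; split=> //; [left|right].
Qed.

Lemma nsm_reflection w A : borel A ->
  normalized_spherical_measure (reflection w @^-1` A) = normalized_spherical_measure A.
Proof.
move=> bA; have bA' := borel_preimage (measurable_reflection w) bA.
rewrite !nsmE//; congr (fine _ / _).
rewrite -(rVm_reflection w (borel_open_cone bA)); congr (rVm _ _).
by apply/seteqP; split=> x; rewrite /open_cone /preimage/= /unit_ball/=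
  -reflection_unitv dotp_reflection.
Qed.

(** Lets a box of known volume bound a spherical measure from below: it only has to lie in the open
    cone over [A]. *)
Lemma nsm_ge_volume A (D : set 'rV[R]_n) (v : R) : borel A -> borel D ->
  (v%:E <= rVm n D)%E ->
  (forall x, D x -> [/\ 0 < dotp x x, dotp x x <= 1 & A (unitv x)]) ->
  v / ball_volume <= normalized_spherical_measure A.
Proof.
move=> bA bD vD DA; rewrite nsmE// ler_pM2r ?invr_gt0 ?ball_volume_gt0//.
rewrite -lee_fin fineK ?rVm_open_cone_fin// (le_trans vD)//.
apply: le_measure; rewrite ?inE//; first exact: borel_open_cone.
by move=> x /DA[].
Qed.

End SphericalMeasureTheory.
Arguments ball_volume R m : clear implicits.

(** * Volume of a cap *)

Section TrigBounds.
Context {R : realType}.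
Implicit Types x : R.

Lemma sin_mvt x : 0 <= x -> exists2 c, 0 <= c <= x & sin x = cos c * x.
Proof.
move=> x0; have [|c] := @MVT_segment R (@sin R) (@cos R) 0 x x0 (fun z _ => is_derive_sin z).
  by apply: continuous_subspaceT; exact: continuous_sin.
by rewrite in_itv/= sin0 !subr0 => h e; exists c.
Qed.

Lemma sin_le_id x : 0 <= x -> sin x <= x.
Proof.
move=> x0; have [c _ ->] := sin_mvt x0.
by rewrite ler_piMl// cos_le1.
Qed.

(** In sin x = x cos c one has cos c = 1 - 2 sin^2 (c/2) >= 1 - c^2/2 >= 1/2. *)
Lemma sin_ge_half x : 0 <= x <= 1 -> x / 2 <= sin x.
Proof.
move=> /andP[x0 x1]; have [c /andP[c0 cx] ->] := sin_mvt x0.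
rewrite mulrC ler_wpM2r//.
have -> : cos c = 1 - 2 * sin (c / 2) ^+ 2.
  rewrite {1}(_ : c = (c / 2) *+ 2) ?cos_mulr2n; last by rewrite -mulr_natr; field.
  by rewrite cos2sin2; ring.
have s0 : 0 <= sin (c / 2).
  by apply: sin_ge0_pi; have := @pi_ge2 R; lra.
have s1 : sin (c / 2) <= c / 2 by apply: sin_le_id; lra.
by nra.
Qed.

End TrigBounds.

Section CapVolume.
Context {R : realType}.

Lemma dotpS n (x y : 'rV[R]_n.+1) :
  dotp x y = x 0 0 * y 0 0 + dotp (tailr x) (tailr y).
Proof.
rewrite /dotp big_ord_recl; congr (_ + _).
by apply: eq_bigr => i _; rewrite !mxE.
Qed.

Lemma rVm_ball n r : 0 < r ->
  rVm n [set x : 'rV[R]_n | dotp x x <= r ^+ 2] = ((r ^+ n)%:E * rVm n (@unit_ball R n))%E.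
Proof.
move=> r0; rewrite -(@rVm_affine R n r 0 [set x | dotp x x <= r ^+ 2])//.
  have E x : (dotp (r *: x + 0) (r *: x + 0) <= r ^+ 2) = (dotp x x <= 1).
    by rewrite addr0 dotpZl dotpZr mulrA -expr2 -[X in _ <= X]mulr1 ler_pM2l// exprn_gt0.
  by congr (_ * rVm n _)%E; apply/seteqP; split=> x; rewrite /unit_ball/= E.
by apply: borel_le => //; exact: measurable_dotp.
Qed.

Lemma rVm_prod2 n (I J : set R) (B : set 'rV[R]_n) :
  measurable (I : set (measurableTypeR R)) ->
  measurable (J : set (measurableTypeR R)) -> borel B ->
  borel [set x : 'rV[R]_n.+2 |
     [/\ I (x 0 0), J (tailr x 0 0) & B (tailr (tailr x))]] /\
  rVm n.+2 [set x : 'rV[R]_n.+2 | [/\ I (x 0 0), J (tailr x 0 0) & B (tailr (tailr x))]] =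
    (lebesgue_measure I * (lebesgue_measure J * rVm n B))%E.
Proof.
move=> mI mJ bB.
have bJB : borel [set x : 'rV[R]_n.+1 | J (x 0 0) /\ B (tailr x)].
  have := @measurable_unconsr R n measurableT _
    (@measurableX _ _ (measurableTypeR R) (rVb R n) _ _ mJ bB).
  by rewrite setTI.
have E : [set x : 'rV[R]_n.+2 |
     [/\ I (x 0 0), J (tailr x 0 0) & B (tailr (tailr x))]] =
    [set x : 'rV[R]_n.+2 | I (x 0 0) /\
       [set x : 'rV[R]_n.+1 | J (x 0 0) /\ B (tailr x)] (tailr x)].
  by apply/seteqP; split=> x /= [? //] [].
rewrite E; split; last by rewrite rVm_prod// rVm_prod.
have := @measurable_unconsr R n.+1 measurableT _
    (@measurableX _ _ (measurableTypeR R) (rVb R n.+1) _ _ mI bJB).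
by rewrite setTI.
Qed.

(** The unit ball of R^(k+3) lies in the product of [-1, 1]^2 and the unit ball of R^(k+1). The
    latter is the last factor in [box_volume], so that after normalization no ball volume remains in
    the constants. *)
Lemma ball_volume_le k : ball_volume R k.+2 <= 4 * ball_volume R k.
Proof.
have mI : measurable (`[(-1), 1]%classic : set (measurableTypeR R)).
  exact: measurable_itv.
have [bD vD] := rVm_prod2 mI mI (@borel_unit_ball R k.+1).
rewrite -lee_fin EFinM -!rVm_unit_ballE.
apply: (@le_trans _ _ (rVm k.+3 [set x : 'rV[R]_k.+3 |
   [/\ `[(-1), 1]%classic (x 0 0), `[(-1), 1]%classic (tailr x 0 0)
     & unit_ball (tailr (tailr x))]])); last first.
  rewrite vD lebesgue_measure_itv/= lte_fin ifT; last by lra.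
  rewrite rVm_unit_ballE -EFinB -!EFinM lee_fin; lra.
apply: le_measure; rewrite ?inE//; first exact: borel_unit_ball.
move=> x; rewrite /unit_ball/= (dotpS x) (dotpS (tailr x)) => h.
have h1 := sqr_ge0 (x 0 0); have h2 := sqr_ge0 (tailr x 0 0).
have h3 := dotp_ge0 (tailr (tailr x)).
have abs1 (t : R) : t ^+ 2 <= 1 -> -1 <= t <= 1.
  move=> ht; rewrite -ler_norml -(@ler_pXn2r _ 2)// ?nnegrE//.
  by rewrite expr1n real_normK ?num_real.
rewrite !in_itv/=; rewrite !expr2 in h1 h2.
by split; [apply: abs1; rewrite expr2|apply: abs1; rewrite expr2|]; lra.
Qed.

(** The first reflection takes [u] to the first basis vector; the second takes the image of [v] to
    the second basis vector and fixes the first, to which both are orthogonal. *)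
Lemma orthonormal_frame n (u v : 'rV[R]_n.+2) :
  dotp u u = 1 -> dotp v v = 1 -> dotp u v = 0 ->
  exists w1 w2 : 'rV[R]_n.+2, forall x,
    dotp x u = (reflection w2 (reflection w1 x)) 0 0 /\
    dotp x v = tailr (reflection w2 (reflection w1 x)) 0 0.
Proof.
move=> uu vv uv.
pose E0 : 'rV[R]_n.+2 := delta_mx 0 0.
pose E1 : 'rV[R]_n.+2 := delta_mx 0 (lift 0 0).
have dE (x : 'rV[R]_n.+2) j : dotp x (delta_mx 0 j) = x 0 j.
  rewrite /dotp (bigD1 j)//= mxE !eqxx mulr1 big1 ?addr0// => i ij.
  by rewrite mxE eqxx/= (negbTE ij) mulr0.
have E00 : dotp E0 E0 = 1 by rewrite dE mxE !eqxx.
have E11 : dotp E1 E1 = 1 by rewrite dE mxE !eqxx.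
have E01 : dotp E0 E1 = 0 by rewrite dE mxE.
pose w1 := u - E0; pose v' := reflection w1 v; pose w2 := v' - E1.
have h1 : reflection w1 u = E0 by apply: reflection_swap; rewrite uu E00.
have h2 : reflection w2 v' = E1.
  by apply: reflection_swap; rewrite dotp_reflection vv E11.
have h3 : reflection w2 E0 = E0.
  apply: reflection_id; rewrite dotpBr E01 subr0 -h1 /v' dotp_reflection//.
exists w1, w2 => x; split.
  by rewrite -dE -/E0 -h3 dotp_reflection -h1 dotp_reflection.
by rewrite mxE -dE -/E1 -h2 dotp_reflection /v' dotp_reflection.
Qed.

Lemma box_volume k (u v : 'rV[R]_k.+3) (s1 s2 c r : R) :
  dotp u u = 1 -> dotp v v = 1 -> dotp u v = 0 -> s1 < s2 -> 0 < c -> 0 < r ->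
  let D := [set x | [/\ s1 <= dotp x u <= s2, - c <= dotp x v <= c &
     dotp x x - dotp x u ^+ 2 - dotp x v ^+ 2 <= r ^+ 2]] in
  borel D /\
  rVm k.+3 D = ((s2 - s1) * (2 * c) * r ^+ k.+1 * ball_volume R k)%:E.
Proof.
move=> uu vv uv s12 c0 r0 D.
have [w1 [w2 w12]] := orthonormal_frame uu vv uv.
have mI : measurable (`[s1, s2]%classic : set (measurableTypeR R)).
  exact: measurable_itv.
have mJ : measurable (`[(- c), c]%classic : set (measurableTypeR R)).
  exact: measurable_itv.
have bB : borel [set x : 'rV[R]_k.+1 | dotp x x <= r ^+ 2].
  by apply: borel_le => //; exact: measurable_dotp.
have [bE vE] := rVm_prod2 mI mJ bB.
set E := [set x | _] in bE vE.
have bE2 := borel_preimage (measurable_reflection w2) bE.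
have DE : D = reflection w1 @^-1` (reflection w2 @^-1` E).
  apply/seteqP; split=> x; rewrite /D /E /preimage/= !in_itv/=;
    have [-> ->] := w12 x; rewrite -{1}(dotp_reflection w1) -{1}(dotp_reflection w2)
     (dotpS (reflection w2 _)) (dotpS (tailr (reflection w2 _)))
     => -[h1 h2 h3]; split=> //; move: h3; rewrite ?expr2; lra.
rewrite DE; split; first exact: borel_preimage (measurable_reflection w1) bE2.
rewrite rVm_reflection// rVm_reflection// vE rVm_ball// !lebesgue_measure_itv/=.
rewrite !lte_fin s12 (_ : - c < c); last by lra.
rewrite rVm_unit_ballE -!EFinB -!EFinM; congr EFin; ring.
Qed.

End CapVolume.

Section CapBound.
Context {R : realType}.
Implicit Types a b eps s t N r : R.

Lemma sin_compl x : sin (pi / 2 - x) = cos x :> R.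
Proof. by rewrite sinB sin_pihalf cos_pihalf mul1r mul0r subr0. Qed.

Lemma cos_compl x : cos (pi / 2 - x) = sin x :> R.
Proof. by rewrite cosB sin_pihalf cos_pihalf mul1r mul0r add0r. Qed.

Lemma cosB_cosD x y : cos (x - y) = cos (x + y) + 2 * sin x * sin y :> R.
Proof. by rewrite cosB cosD; ring. Qed.

Lemma le_sin x y : 0 <= x -> x <= y -> y <= pi / 2 -> sin x <= sin y :> R.
Proof.
move=> x0 xy y1; have pi0 := @pi_gt0 R; rewrite leNgt; apply/negP.
by rewrite ltr_sin ?in_itv/= ?ltNge ?xy//; apply/andP; split; lra.
Qed.

(** With p = pi/2 - a - eps/4 the two sines are cos (p + eps/4) and cos (p - eps/4), whose
    difference is 2 sin p sin (eps/4). The bound on sin p degenerates with pi/2 - a, as does the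
    room that the box has near [e]. *)
Lemma cap_trig a eps : 0 < a -> a < pi / 2 -> 0 < eps ->
  eps <= 2 * (pi / 2 - a) ->
  exists sp sq, [/\ sin (a + eps / 2) = sin a + 2 * sp * sq,
    (pi / 2 - a) / 4 <= sp, eps / 8 <= sq & 0 <= cos (a + eps / 2) <= sp].
Proof.
move=> a0 ah e0 eb; have p2 := @pihalf_lt2 R.
pose p := pi / 2 - a - eps / 4.
have ea : sin a = cos (p + eps / 4).
  by rewrite -sin_compl /p; congr sin; field.
have eS : sin (a + eps / 2) = cos (p - eps / 4).
  by rewrite -sin_compl /p; congr sin; field.
have eC : cos (a + eps / 2) = sin (p - eps / 4).
  by rewrite -cos_compl /p; congr cos; field.
exists (sin p), (sin (eps / 4)); split.
- by rewrite eS ea cosB_cosD.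
- apply: (@le_trans _ _ (sin ((pi / 2 - a) / 2))).
    rewrite (_ : (pi / 2 - a) / 4 = (pi / 2 - a) / 2 / 2); last by field.
    by apply: sin_ge_half; clear -a0 ah p2; lra.
  by apply: le_sin => //; rewrite /p; clear -ah a0 e0 eb; lra.
- rewrite (_ : eps / 8 = eps / 4 / 2); last by field.
  by apply: sin_ge_half; clear -e0 eb p2 a0; lra.
- rewrite eC; apply/andP; split.
    by apply: sin_ge0_pi; rewrite /p; clear -a0 e0 eb ah; lra.
  by apply: le_sin; rewrite /p; clear -a0 e0 eb ah; lra.
Qed.

(** The 58 is 50 + 8: t^2 <= eps^2/400 with eps <= 2 b gives 50, and (a b)^2 <= 8 b gives 8. *)
Lemma cap_radius_bound a b eps t r : 0 < a -> a < 2 -> 0 < b -> b < 2 -> 0 < eps ->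
  eps <= 2 * b -> - (eps / 20) <= t <= eps / 20 ->
  r ^+ 2 <= (a * b) ^+ 2 * eps / 10000 ->
  t ^+ 2 + r ^+ 2 <= b * eps * 58 / 10000.
Proof.
move=> a0 a2 b0 b2 e0 eb /andP[t1 t2] hr.
have h1 : 0 <= (eps / 20 - t) * (eps / 20 + t).
  by rewrite mulr_ge0//; [clear -t2|clear -t1]; lra.
have h2 : 0 <= eps * (2 * b - eps) by rewrite mulr_ge0 ?(ltW e0)// subr_ge0.
have ha : a * a <= 2 * 2 by rewrite ler_pM ?ltW.
have hb : b * b <= 2 * b by rewrite ler_wpM2r ?ltW.
have h3 : a * a * (b * b) <= 2 * 2 * (2 * b).
  by rewrite ler_pM// mulr_ge0 ?ltW.
have h4 := ler_wpM2r (ltW e0) h3.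
by clear -h1 h2 h4 hr; rewrite !expr2 in hr *; lra.
Qed.

(** Here s and t are the coordinates of a point of the box along [u] and [v], and N is its norm.
    Since s >= 1/2, N exceeds s by at most t^2 + r^2, a loss of 58/10000 b eps where b = pi/2 - a.
    The axis gains sp eps/8, the [v] direction costs at most sp eps/20, and sp >= b/4 leaves at
    least 3/160 b eps. *)
Lemma cap_axis_bound a eps s t N r :
  0 < a -> a < pi / 2 -> 0 < eps -> eps <= 2 * (pi / 2 - a) ->
  2^-1 <= s -> - (eps / 20) <= t <= eps / 20 -> 0 <= N ->
  r ^+ 2 <= (a * (pi / 2 - a)) ^+ 2 * eps / 10000 ->
  N ^+ 2 <= s ^+ 2 + t ^+ 2 + r ^+ 2 ->
  sin a * N <= sin (a + eps / 2) * s + cos (a + eps / 2) * t.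
Proof.
move=> a0 ah e0 eb s1 ht N0 hr hN.
have [sp [sq [-> hsp hsq /andP[C0 C1]]]] := cap_trig a0 ah e0 eb.
have p2 := @pihalf_lt2 R; have p1 := @pihalf_ge1 R.
have sa1 := sin_le1 a.
have sa0 : 0 <= sin a.
  by apply: sin_ge0_pi; rewrite ltW//=; clear -ah p1 a0; lra.
have b0 : 0 < pi / 2 - a by rewrite subr_gt0.
have hz : t ^+ 2 + r ^+ 2 <= (pi / 2 - a) * eps * 58 / 10000.
  apply: (cap_radius_bound a0 _ b0) => //; first exact: lt_trans p2.
  by clear -p2 a0; lra.
move: hsp b0 hz; set b := pi / 2 - a => hsp b0 hz.
have z0 : 0 <= t ^+ 2 + r ^+ 2 by rewrite addr_ge0 ?sqr_ge0.
have NL : N <= s + (t ^+ 2 + r ^+ 2).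
  have s0 : 0 <= s by apply: le_trans s1; rewrite invr_ge0.
  rewrite -(@ler_pXn2r _ 2)// ?nnegrE; last by rewrite addr_ge0.
  apply: (le_trans hN); rewrite -addrA; clear -z0 s1.
  by move: (t ^+ 2 + r ^+ 2) z0 => z z0; nra.
have sp0 : 0 <= sp by apply: le_trans hsp; rewrite divr_ge0// ltW.
have L1 : sin a * N <= sin a * s + b * eps * 58 / 10000.
  apply: (@le_trans _ _ (sin a * (s + (t ^+ 2 + r ^+ 2)))); first exact: ler_wpM2l.
  by rewrite mulrDr lerD2l (le_trans _ hz)// ler_piMl.
have L2 : - (sp * (eps / 20)) <= cos (a + eps / 2) * t.
  have /andP[t1 t2] := ht.
  have h1 : cos (a + eps / 2) * (- (eps / 20)) <= cos (a + eps / 2) * t.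
    by rewrite ler_wpM2l.
  have h2 : cos (a + eps / 2) * (eps / 20) <= sp * (eps / 20).
    by rewrite ler_wpM2r// divr_ge0// ltW.
  by clear -h1 h2; lra.
have L3 : sp * (eps / 8) <= 2 * sp * sq * s.
  have h1 : sp * (eps / 8) <= sp * sq by rewrite ler_wpM2l.
  have h2 : 0 <= sp * sq by apply: le_trans h1; rewrite mulr_ge0// divr_ge0// ltW.
  have h3 := ler_wpM2l h2 s1.
  by clear -h1 h3; lra.
have L4 : b / 4 * eps <= sp * eps by rewrite ler_wpM2r// ltW.
have be0 : 0 < b * eps by rewrite mulr_gt0.
by clear -L1 L2 L3 L4 be0; lra.
Qed.

Lemma cap_measure k a eps delta (e y : 'rV[R]_k.+3) :
  0 < a -> a < pi / 2 -> 0 < eps -> eps <= 1 ->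
  sphere e -> sphere y -> - cos a <= dotp e y -> dotp e y <= cos (a + eps) ->
  a + eps <= pi -> 0 <= delta -> delta <= eps / 20 ->
  eps * (a * (pi / 2 - a) * Num.sqrt eps / 100) ^+ k.+1 / 100 <=
  normalized_spherical_measure
    [set x | sin a <= dotp x e /\ dotp x y < - delta].
Proof.
move=> a0 ah e0 e1 se sy ey1 ey2 aepi d0 d1.
have p2 := @pihalf_lt2 R; have p1 := @pihalf_ge1 R.
set r := a * _ * _ / _.
have b0 : 0 < pi / 2 - a by rewrite subr_gt0.
have r0 : 0 < r by rewrite divr_gt0// !mulr_gt0// sqrtr_gt0.
have r2 : r ^+ 2 = (a * (pi / 2 - a)) ^+ 2 * eps / 10000.
  rewrite /r expr_div_n [in LHS]exprMn sqr_sqrtr ?ltW//; congr (_ / _); ring.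
have c1 : -1 <= dotp e y by apply: le_trans ey1; rewrite lerN2 cos_le1.
have c2 : dotp e y <= 1 by apply: (le_trans ey2); rewrite cos_le1.
pose th := acos (dotp e y).
have cth : cos th = dotp e y by rewrite acosK// in_itv/= c1.
have th0 : 0 <= th by rewrite acos_ge0 ?c1.
have th1 : th <= pi by rewrite acos_lepi ?c1.
have th2 : a + eps <= th.
  rewrite leNgt; apply/negP => h.
  move: ey2; rewrite -cth leNgt ltr_cos ?h// in_itv/=; apply/andP; split=> //.
  by clear -a0 e0 aepi; lra.
have th3 : th <= pi - a.
  rewrite leNgt; apply/negP => h.
  have : cos th < cos (pi - a) by rewrite ltr_cos// in_itv/=; apply/andP; split=> //;
      clear -a0 ah p1; lra.
  by rewrite cosB cospi sinpi mul0r addr0 mulN1r cth; clear -ey1; lra.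
(* The angle [th] lies in [a + eps, pi - a], which limits eps in terms of a. *)
have eb : eps <= 2 * (pi / 2 - a) by clear -th2 th3; lra.
have s0 : 0 < sin th by apply: sin_gt0_pi; clear -th2 th3 a0 e0; lra.
have sc : cos th ^+ 2 + sin th ^+ 2 = 1 := cos2Dsin2 th.
(* Division is safe because [y] is neither [e] nor its antipode. *)
pose f := (sin th)^-1 *: (y - cos th *: e).
have yE : y = cos th *: e + sin th *: f.
  by rewrite /f scalerA divff ?gt_eqF// scale1r addrC subrK.
have ef : dotp e f = 0 by rewrite /f !dotpE se cth mulr1 subrr mulr0.
clearbody f.
have ff : dotp f f = 1.
  have : dotp y y = 1 by [].
  rewrite {1 2}yE !dotpE se (dotpC f e) ef => h.
  have /eqP : sin th ^+ 2 * (dotp f f - 1) = 0 by clear -h sc; lra.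
  by rewrite mulf_eq0 sqrf_eq0 gt_eqF//= subr_eq0 => /eqP.
pose S := sin (a + eps / 2); pose C := cos (a + eps / 2).
have SC : C ^+ 2 + S ^+ 2 = 1 := cos2Dsin2 _.
(* The hypersphere of [u] passes at distance a + eps/2 from [e], with [y] strictly beyond it; [v] is
   the direction of the plane orthogonal to [u]. *)
pose u := S *: e - C *: f; pose v := C *: e + S *: f.
have uu : dotp u u = 1.
  by rewrite /u !dotpE se ff (dotpC f e) ef -[RHS]SC; ring.
have vv : dotp v v = 1.
  by rewrite /v !dotpE se ff (dotpC f e) ef -[RHS]SC; ring.
have uv : dotp u v = 0.
  by rewrite /u /v !dotpE se ff (dotpC f e) ef; ring.
have eE : e = S *: u + C *: v.
  by apply/rowP => i; rewrite !mxE -[LHS]mul1r -{1}SC; ring.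
have fE : f = S *: v - C *: u.
  by apply/rowP => i; rewrite !mxE -[LHS]mul1r -{1}SC; ring.
clearbody u v.
pose psi := th - (a + eps / 2).
have xy x : dotp x y = - (dotp x u * sin psi) + dotp x v * cos psi.
  rewrite yE {1}eE fE !dotpE sinB cosB -/S -/C; ring.
have xe x : dotp x e = S * dotp x u + C * dotp x v by rewrite {1}eE !dotpE.
have spsi : eps / 4 <= sin psi.
  have h : eps / 4 <= sin (eps / 2).
    by rewrite (_ : eps / 4 = eps / 2 / 2); [apply: sin_ge_half; clear -e0 e1; lra|field].
  have [h1|h1] := leP psi (pi / 2).
    by apply: (le_trans h); apply: le_sin => //; rewrite /psi; clear -e0 th2; lra.
  rewrite (_ : sin psi = sin (pi - psi)); last by rewrite sinB sinpi cospi; ring.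
  apply: (le_trans h); apply: le_sin; first by clear -e0; lra.
    by rewrite /psi; clear -th3 a0 e0; lra.
  by clear -h1; lra.
have cpsi : -1 <= cos psi <= 1 by rewrite cos_geN1 cos_le1.
have c20 : 0 < eps / 20 by rewrite divr_gt0.
(* The lower end 1/2 is required by [cap_axis_bound]; the upper end 9/10 keeps the box in the unit
   ball, as 81/100 + 1/400 + 1/50 < 1. *)
have s12 : 2^-1 < 9 / 10 :> R by clear; lra.
have [bD vD] := box_volume uu vv uv s12 c20 r0; set D := [set x | _] in bD vD.
have bA : borel [set x : 'rV[R]_k.+3 | sin a <= dotp x e /\ dotp x y < - delta].
  apply: (@measurableI _ (rVb R k.+3) [set x : 'rV[R]_k.+3 | sin a <= dotp x e]).
    by apply: borel_le => //; exact: measurable_dotp.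
  by apply: borel_lt => //; exact: measurable_dotp.
(* The side lengths 4/10 and eps/10 give eps/25; the factor 4 of [ball_volume_le] makes it
   eps/100. *)
have vD' : (((9 / 10 - 2^-1) * (2 * (eps / 20)) * r ^+ k.+1 * ball_volume R k)%:E
  <= rVm k.+3 D)%E by rewrite vD.
apply: le_trans (nsm_ge_volume bA bD vD' _).
  rewrite ler_pdivlMr ?ball_volume_gt0//.
  have h := ball_volume_le (R:=R) k; have rk : 0 < eps * r ^+ k.+1 by rewrite mulr_gt0 ?exprn_gt0.
  have := ler_wpM2l (ltW rk) h; clear; lra.
move=> x [/andP[h1 h2] /andP[h3 h4] h5].
have r1 : r ^+ 2 <= 1 / 50.
  have := @cap_radius_bound a (pi / 2 - a) eps 0 r a0 (lt_trans ah p2) b0.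
  have -> : pi / 2 - a < 2 by clear -p2 a0; lra.
  have -> : - (eps / 20) <= 0 <= eps / 20 by clear -e0; lra.
  rewrite e0 eb r2 lexx => /(_ isT isT isT isT isT); rewrite expr0n/= add0r.
  have b2 : pi / 2 - a <= 2 by clear -p2 a0; lra.
  have := ler_pM (ltW b0) (ltW e0) b2 e1.
  by move: (a * _) => w; clear; lra.
have xx : dotp x u ^+ 2 <= dotp x x.
  have := dotp_ge0 (x - dotp x u *: u).
  by rewrite !dotpE (dotpC u x) uu; clear; lra.
have xx1 : dotp x x <= 1.
  have s81 : dotp x u ^+ 2 <= 81 / 100 by rewrite expr2; clear -h1 h2; nra.
  have t400 : dotp x v ^+ 2 <= 1 / 400.
    by rewrite expr2; clear -h3 h4 e1 e0; move: (dotp x v) h3 h4 => z; nra.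
  by clear -s81 t400 h5 r1; lra.
have xx0 : 0 < dotp x x by apply: lt_le_trans xx; rewrite exprn_gt0//; clear -h1; lra.
have N0 : 0 < Num.sqrt (dotp x x) by rewrite sqrtr_gt0.
split=> //.
rewrite /= /unitv !dotpE; set N := Num.sqrt _ in N0 *.
have N1 : N <= 1 by rewrite /N -sqrtr1 ler_sqrt.
have NN : N ^+ 2 = dotp x x by rewrite sqr_sqrtr// ltW.
split.
  rewrite mulrC ler_pdivlMr// xe.
  apply: (@cap_axis_bound a eps _ _ N r) => //; [by rewrite h3|exact: ltW|by rewrite r2|].
  by rewrite NN; clear -h5; lra.
(* The distance of [y] beyond the hypersphere contributes eps/8, more than the drift eps/20 along
   [v] and [delta] * N <= eps/20 together. *)
rewrite mulrC ltr_pdivrMr// xy.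
have A1 : delta * N <= eps / 20.
  by rewrite -[eps / 20]mulr1 ler_pM// ltW.
have /andP[cp1 cp2] := cpsi.
have A2 : dotp x v * cos psi <= eps / 20.
  rewrite (le_trans (ler_norm _))// normrM -[eps / 20]mulr1.
  by rewrite ler_pM// ler_norml ?h3// cp1.
have A3 : eps / 8 <= dotp x u * sin psi.
  rewrite (_ : eps / 8 = 2^-1 * (eps / 4)); last by field.
  by rewrite ler_pM// ?invr_ge0// divr_ge0// ltW.
by clear -A1 A2 A3 e0; lra.
Qed.

End CapBound.

(** * Cells as intersections of hemispheres *)

Section Continuity.
Context {R : realType} {n : nat}.

Lemma cvg_dotp (T : Type) (F : set_system T) {FF : Filter F}
    (f g : T -> 'rV[R]_n) (a b : 'rV[R]_n) :
  f @ F --> a -> g @ F --> b -> (fun t => dotp (f t) (g t)) @ F --> dotp a b.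
Proof.
move=> fa gb.
have coord (h : T -> 'rV[R]_n) (c : 'rV[R]_n) i : h @ F --> c -> (fun t => h t 0 i) @ F --> c 0 i.
  move=> hc; have cc := @coord_continuous R 1 n 0 i c.
  exact: (cvg_comp _ _ hc cc).
rewrite /dotp; elim: (index_enum 'I_n) => [|i s IH].
  rewrite big_nil; under eq_fun do rewrite big_nil.
  exact: cvg_cst.
rewrite big_cons; under eq_fun do rewrite big_cons.
by apply: cvgD => //; apply: cvgM; exact: coord.
Qed.

Lemma continuous_dotp (x : 'rV[R]_n) : continuous (dotp x).
Proof.
move=> y; apply: (@cvg_dotp _ (nbhs y) _ (fun=> x) id x y); last exact: cvg_id.
exact: cvg_cst.
Qed.

Lemma cvg_unitv (T : Type) (F : set_system T) {FF : Filter F}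
    (f : T -> 'rV[R]_n) (a : 'rV[R]_n) :
  a != 0 -> f @ F --> a -> (fun t => unitv (f t)) @ F --> unitv a.
Proof.
move=> a0 fa; apply: cvgZ => //.
apply: (@cvgV _ _ _ _ (fun t => Num.sqrt (dotp (f t) (f t)))).
  by rewrite gt_eqF// sqrt_dotp_gt0.
by apply: continuous_cvg; [exact: sqrt_continuous|exact: cvg_dotp].
Qed.

Lemma continuous_scale_dotp (c : R) (x : 'rV[R]_n) :
  continuous (fun y => c * dotp x y).
Proof.
move=> y; apply: (@cvgM _ _ (nbhs y) _ (fun=> c) (dotp x)); first exact: cvg_cst.
exact: continuous_dotp.
Qed.

Lemma closed_sphere : closed (@sphere R n).
Proof.
rewrite (_ : sphere = (fun x : 'rV[R]_n => dotp x x) @^-1` [set 1])//.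
apply: preimage_closed; last exact: closed_eq.
by move=> x _; apply: (@cvg_dotp _ (nbhs x) _ id id x x); exact: cvg_id.
Qed.

Lemma sphere_coord_le1 (x : 'rV[R]_n) i : sphere x -> `|x 0 i| <= 1.
Proof.
rewrite /sphere/= => h.
rewrite -(@ler_pXn2r _ 2)// ?nnegrE// expr1n real_normK ?num_real// -h.
rewrite /dotp (bigD1 i)//= -expr2 lerDl.
by apply: sumr_ge0 => j _; rewrite -expr2 sqr_ge0.
Qed.

Lemma compact_sphere : compact (@sphere R n).
Proof.
apply: bounded_closed_compact; last exact: closed_sphere.
exists 1; split=> // M M1 x sx; rewrite /= [leLHS]mx_normrE.
apply: bigmax_le => [|i _]; first by rewrite (le_trans ler01)// ltW.
by rewrite ord1 (le_trans (sphere_coord_le1 _ sx))// ltW.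
Qed.

End Continuity.

Section Cells.
Context {R : realType} {m : nat}.
Local Notation n := m.+2.
Implicit Types (x y e p q : 'rV[R]_n) (X : seq 'rV[R]_n).

Lemma unitv_segment_neq0 p y (t : R) : sphere p -> sphere y -> y != - p ->
  0 <= t <= 1 -> (1 - t) *: p + t *: y != 0.
Proof.
move=> sp sy yp /andP[t0 t1]; rewrite -dotp_eq0 !dotpE sp sy (dotpC y p) gt_eqF//.
have : 0 < dotp (p + y) (p + y) by rewrite dotp_gt0// addrC addr_eq0.
rewrite !dotpE sp sy (dotpC y p); move: (dotp p y) => c h.
have w0 : 0 <= t * (1 - t) by rewrite mulr_ge0// subr_ge0.
have w1 := sqr_ge0 (1 - 2 * t); rewrite expr2 in w1.
have s0 : 0 < 1 + c by clear -h; lra.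
have := mulr_ge0 w0 (ltW s0); have [w8|w8] := leP (t * (1 - t)) (1 / 8) => ws.
  by clear -w8 ws; lra.
have := mulr_gt0 (le_lt_trans _ w8) s0; rewrite divr_ge0// => /(_ isT).
by clear -w1; lra.
Qed.

Lemma continuous_segment p y : continuous (fun t : R => (1 - t) *: p + t *: y).
Proof.
move=> t; apply: (@cvgD _ _ _ (nbhs t)).
  apply: cvgZr_tmp; apply: (@cvgB _ _ _ (nbhs t)); last exact: cvg_id.
  exact: cvg_cst.
apply: cvgZr_tmp; exact: cvg_id.
Qed.

(** The path is the chord projected radially to the sphere; it avoids the origin unless the ends are
    antipodal. *)
Lemma path_component (S : set 'rV[R]_n) p y : sphere p -> sphere y -> y != - p ->
  (forall t, 0 <= t <= 1 -> S (unitv ((1 - t) *: p + t *: y))) ->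
  connected_component S p y.
Proof.
move=> sp sy yp hS; pose f (t : R) := unitv ((1 - t) *: p + t *: y).
exists (f @` `[0, 1]); last first.
  by exists 1; rewrite /= ?in_itv/= ?ler01 ?lexx// /f subrr scale0r add0r scale1r unitv_id.
split.
- by exists 0; rewrite /= ?in_itv/= ?ler01 ?lexx// /f subr0 scale0r addr0 scale1r unitv_id.
- by move=> z [t /=]; rewrite in_itv/= => ht <-; exact: hS.
- apply: connected_continuous_connected; first exact: segment_connected.
  apply/continuous_in_subspaceT => t /set_mem/=; rewrite in_itv/= => ht.
  apply: cvg_unitv; first exact: unitv_segment_neq0.
  exact: (@continuous_segment p y t).
Qed.

Lemma exists_orthogonal x : sphere x -> exists2 g, sphere g & dotp x g = 0.
Proof.
move=> sx; have s0 : sphere (delta_mx 0 0 : 'rV[R]_n).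
  by rewrite /sphere/= /dotp (bigD1 0)//= !mxE !eqxx mulr1 big1 ?addr0// => i /negbTE i0;
    rewrite !mxE i0 mulr0.
pose g0 : 'rV[R]_n := delta_mx 0 (lift 0 0).
pose w := delta_mx 0 0 - x.
have hx : reflection w (delta_mx 0 0) = x by apply: reflection_swap; rewrite s0 sx.
exists (reflection w g0).
  rewrite /sphere/= dotp_reflection /dotp (bigD1 (lift 0 0))//= !mxE !eqxx mulr1.
  by rewrite big1 ?addr0// => i /negbTE i0; rewrite !mxE i0 mulr0.
rewrite -{1}hx dotp_reflection /dotp big1// => i _; rewrite !mxE.
by case: (unliftP 0 i) => [j ->|->]; rewrite /= ?mul0r ?mulr0.
Qed.

Definition off_planes p X := forall x, x \in X -> dotp x p != 0.

(** The sign factor selects, for each hypersphere, the side of [p]. *)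
Definition open_cell p X : set 'rV[R]_n :=
  sphere `&` [set y | forall x, x \in X -> 0 < Num.sg (dotp x p) * dotp x y].

Definition closed_cell p X : set 'rV[R]_n :=
  sphere `&` [set y | forall x, x \in X -> 0 <= Num.sg (dotp x p) * dotp x y].

Lemma off_hyperspheresP X y :
  off_hyperspheres X y <-> sphere y /\ off_planes y X.
Proof.
rewrite /off_hyperspheres /great_hypersphere /off_planes; split.
  move=> [sy ny]; split=> // x xX; apply/eqP => h; apply: ny.
  by exists x.
move=> [sy oy]; split=> // -[x /= xX [_ h]].
by have := oy x xX; rewrite h eqxx.
Qed.

Lemma sg_mul_dotp_gt0 p x : dotp x p != 0 -> 0 < Num.sg (dotp x p) * dotp x p.
Proof. by move=> h; rewrite -normrEsg normr_gt0. Qed.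

Lemma component_open_cell p X : sphere p -> off_planes p X ->
  connected_component (off_hyperspheres X) p = open_cell p X.
Proof.
move=> sp op; apply/seteqP; split=> y.
  move=> [C [Cp CX cC] Cy]; have /off_hyperspheresP[sy oy] := CX _ Cy.
  split=> // x xX.
  have : connected (dotp x @` C).
    apply: connected_continuous_connected => //.
    by apply: continuous_subspaceT; exact: continuous_dotp.
  move/connected_intervalP => iC.
  have no0 : ~ (dotp x @` C) 0.
    move=> [z Cz z0]; have /off_hyperspheresP[_ oz] := CX _ Cz.
    by have := oz x xX; rewrite z0 eqxx.
  have ip : (dotp x @` C) (dotp x p) by exists p.
  have iy : (dotp x @` C) (dotp x y) by exists y.
  have xp := op x xX; have xy := oy x xX.
  have [xp0|xp0] := ltP 0 (dotp x p).
    rewrite gtr0_sg// mul1r ltNge; apply/negP => h; apply: no0.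
    by apply: (iC (dotp x y) (dotp x p)) => //; rewrite h ltW.
  have xpn : dotp x p < 0 by rewrite lt_neqAle xp.
  rewrite ltr0_sg// mulN1r oppr_gt0 ltNge; apply/negP => h; apply: no0.
  by apply: (iC (dotp x p) (dotp x y)) => //; rewrite h xp0.
move=> [sy oy].
have path q z : sphere q -> sphere z -> z != - q ->
    (forall x, x \in X -> 0 < Num.sg (dotp x p) * dotp x q) ->
    (forall x, x \in X -> 0 < Num.sg (dotp x p) * dotp x z) ->
    connected_component (off_hyperspheres X) q z.
  move=> sq sz zq hq hz; apply: path_component => // t /andP[t0 t1].
  have z0 : (1 - t) *: q + t *: z != 0 by apply: unitv_segment_neq0 => //; rewrite t0.
  apply/off_hyperspheresP; split; first exact: sphere_unitv.
  move=> x xX; rewrite /unitv dotpZr mulf_neq0 ?invr_neq0//.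
    by rewrite gt_eqF// sqrt_dotp_gt0.
  have h1 := hq x xX; have h2 := hz x xX; apply/eqP => h.
  have {h} : Num.sg (dotp x p) * ((1 - t) * dotp x q + t * dotp x z) = 0.
    by rewrite -!dotpZr -dotpDr h mulr0.
  move: h1 h2; rewrite mulrDr !(mulrCA (Num.sg _)).
  move: (_ * dotp x q) (_ * dotp x z) => a1 a2; clear -t0 t1 => h1 h2.
  by nra.
have hp x : x \in X -> 0 < Num.sg (dotp x p) * dotp x p.
  by move=> xX; apply: sg_mul_dotp_gt0; exact: op.
(* The antipode of [p] lies in the open cell only for the empty configuration; then the path goes
   through a point orthogonal to [p]. *)
have [yp|yp] := eqVneq y (- p); last exact: path.
case: X op oy path hp => [|x X] op oy path hp; last first.
  have := oy x (mem_head _ _); have := hp x (mem_head _ _).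
  by rewrite yp dotpNr; lra.
have [g sg xg] := exists_orthogonal sp.
apply: (@connected_component_trans _ _ g); apply: path => //; apply/eqP.
  by move=> gp; move: xg; rewrite gp dotpNr sp; lra.
by rewrite yp => /oppr_inj gp; move: xg; rewrite -gp sp; lra.
Qed.

Lemma nbhs_unitv p w (U : set 'rV[R]_n) : sphere p -> nbhs p U ->
  exists2 t : R, 0 < t < 1 & U (unitv (p + t *: w)).
Proof.
move=> sp Up.
have cv : unitv (p + t *: w) @[t --> (0:R)] --> p.
  rewrite -[X in _ --> X](unitv_id sp) -[X in _ --> unitv X]addr0 -(scale0r w).
  apply: cvg_unitv; first by rewrite scale0r addr0 sphere_neq0.
  apply: cvgD; first exact: cvg_cst.
  apply: cvgZr_tmp; exact: cvg_id.
have : \forall t \near (0 : R), U (unitv (p + t *: w)) by exact: cv.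
move=> /nbhs_ballP[d /= d0 h]; exists (Num.min (d / 2) (2^-1)).
  rewrite lt_min gt_min divr_gt0//= invr_gt0 ltr0n/=.
  by rewrite invf_lt1// ltr1n orbT.
apply: h; rewrite /ball/= sub0r normrN gtr0_norm.
  by rewrite gt_min ltr_pdivrMr// ltr_pMr// ltr1n.
by rewrite lt_min divr_gt0//= invr_gt0 ltr0n.
Qed.

Lemma closed_closed_cell p X : closed (closed_cell p X).
Proof.
apply: closedI; first exact: closed_sphere.
rewrite (_ : [set y | _] = \bigcap_(x in [set` X])
   (fun y => Num.sg (dotp x p) * dotp x y) @^-1` [set t : R | 0 <= t]); last first.
  by apply/seteqP; split=> y h x /=; exact: h.
apply: closed_bigI => x _; apply: preimage_closed; last exact: closed_ge.
by move=> y _; exact: continuous_scale_dotp.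
Qed.

Lemma closure_open_cell p X : sphere p -> off_planes p X ->
  closure (open_cell p X) = closed_cell p X.
Proof.
move=> sp op; apply/seteqP; split.
  rewrite [X in _ `<=` X](closure_id _).1; last exact: closed_closed_cell.
  by apply: closureS => y [sy hy]; split=> // x xX; rewrite ltW// hy.
case: X op => [|x0 X] op; first by move=> y [sy _]; apply: subset_closure; split.
(* Tilting [y] slightly towards [p] makes every inequality strict. *)
move=> y [sy hy] U Uy; have [t /andP[t0 t1] Ut] := nbhs_unitv p sy Uy.
exists (unitv (y + t *: p)); split=> //.
have h x : x \in x0 :: X -> 0 < Num.sg (dotp x p) * dotp x (y + t *: p).
  move=> xX; rewrite !dotpE mulrDr ltr_wpDl ?hy//.
  by rewrite mulrCA mulr_gt0// sg_mul_dotp_gt0// op.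
have z0 : y + t *: p != 0.
  by apply/eqP => z0; have := h x0 (mem_head _ _); rewrite z0 dotp0r mulr0 ltxx.
split; first exact: sphere_unitv.
by move=> x xX; rewrite dotpZr mulrCA mulr_gt0 ?invr_gt0 ?sqrt_dotp_gt0// h.
Qed.

Lemma open_cell_nbhs p X : sphere p -> off_planes p X ->
  \forall y \near p, sphere y -> open_cell p X y.
Proof.
move=> sp op.
have : \forall y \near p, forall x, x \in X -> 0 < Num.sg (dotp x p) * dotp x y.
  elim: X op => [|x X IH] op; first by near=> y.
  have h1 : \forall y \near p, 0 < Num.sg (dotp x p) * dotp x y.
    have cv : (Num.sg (dotp x p) * dotp x y) @[y --> p] --> Num.sg (dotp x p) * dotp x p.
      exact: continuous_scale_dotp.
    apply: (cvgr_gt _ cv); apply: sg_mul_dotp_gt0; apply: op; exact: mem_head.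
  have h2 := IH (fun z zX => op z (mem_behead (s := x :: X) zX)).
  near=> y; move=> z; rewrite inE => /predU1P[->|zX].
    by near: y.
  by move: z zX; near: y.
by apply: filterS => y hy sy; split.
Unshelve. all: by end_near. Qed.

(** If [p] lay on the hypersphere of some x, a small move away from the side of [x0] would leave the
    cell, so [p] would not be interior. Off the hyperspheres, [open_cell p X] contains the points of
    the sphere near [p], so it meets the component, and components that meet coincide. *)
Lemma crofton_cellE p X Z : sphere p ->
  is_cell X Z /\ sphere_interior Z p <-> off_planes p X /\ Z = closed_cell p X.
Proof.
move=> sp; split; last first.
  move=> [op ->]; have offp : off_hyperspheres X p by apply/off_hyperspheresP.
  split.
    by exists p => //; rewrite component_open_cell// closure_open_cell.
  split=> //; rewrite /within/=; apply: filterS (open_cell_nbhs sp op) => y h sy.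
  have [_ hy] := h sy; split=> // x xX; rewrite ltW//; exact: hy.
move=> [[x0 offx0 ->] [_ pZ]].
have [sx0 ox0] := (off_hyperspheresP X x0).1 offx0.
have Zp : closure (connected_component (off_hyperspheres X) x0) p.
  exact: (nbhs_singleton pZ).
have op : off_planes p X.
  move=> x xX; apply/eqP => xp; have xx0 := ox0 x xX.
  pose w := - (Num.sg (dotp x x0) *: x).
  have [t /andP[t0 _] Zt] := nbhs_unitv w sp pZ.
  have ptw : dotp x (p + t *: w) = - (t * (Num.sg (dotp x x0) * dotp x x)).
    by rewrite /w !dotpE xp add0r mulrN.
  have pw0 : p + t *: w != 0.
    apply/eqP => h; have : dotp (p + t *: w) p = 1 by rewrite /w !dotpE xp sp; ring.
    by rewrite h dotp0l => /eqP; rewrite eq_sym oner_eq0.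
  have := Zt (sphere_unitv pw0).
  rewrite component_open_cell// closure_open_cell// => -[_ /(_ x xX)].
  rewrite /unitv dotpZr ptw mulrN mulrN oppr_ge0 leNgt => /negP; apply.
  rewrite mulrCA mulr_gt0 ?invr_gt0 ?sqrt_dotp_gt0// mulrCA mulr_gt0//.
  rewrite mulrA -expr2 sqr_sg xx0 mul1r dotp_gt0//.
  by apply/eqP => x_eq0; rewrite x_eq0 dotp0l eqxx in xx0.
have [q [qC qO]] : (connected_component (off_hyperspheres X) x0 `&` open_cell p X) !=set0.
  have [q [qC qO]] := Zp _ (open_cell_nbhs sp op).
  exists q; split=> //; apply: qO.
  by have /off_hyperspheresP[] := connected_component_sub qC.
split=> //; rewrite -closure_open_cell// -component_open_cell//.
rewrite -component_open_cell// in qO.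
by rewrite (same_connected_component qC) (same_connected_component qO).
Qed.

End Cells.

(** * Inradius and incenter *)

Section CauchySchwarz.
Context {R : realType} {n : nat}.
Implicit Types u x y e : 'rV[R]_n.

Lemma cauchy_schwarz x y : dotp x y ^+ 2 <= dotp x x * dotp y y.
Proof.
have [->|y0] := eqVneq y 0; first by rewrite !dotp0r mulr0 expr0n.
have yy := dotp_gt0 y0; have := dotp_ge0 (dotp y y *: x - dotp x y *: y).
rewrite !dotpE (dotpC y x) => h.
have : 0 <= dotp y y * (dotp x x * dotp y y - dotp x y ^+ 2) by rewrite !expr2; lra.
by rewrite pmulr_rge0// subr_ge0.
Qed.

Lemma dotp_sphere_le1 x y : sphere x -> sphere y -> -1 <= dotp x y <= 1.
Proof.
move=> sx sy; rewrite -ler_norml -(@ler_pXn2r _ 2)// ?nnegrE// expr1n.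
by rewrite real_normK ?num_real// (le_trans (cauchy_schwarz x y))// sx sy mulr1.
Qed.

(** Cauchy-Schwarz for the components of [u] and [y] orthogonal to [e]; it serves as the triangle
    inequality for angles. *)
Lemma spherical_cos_rule u e y : sphere u -> sphere e -> sphere y ->
  (dotp u y - dotp u e * dotp e y) ^+ 2 <=
  (1 - dotp u e ^+ 2) * (1 - dotp e y ^+ 2).
Proof.
move=> su se sy; have := cauchy_schwarz (u - dotp u e *: e) (y - dotp e y *: e).
rewrite !dotpE se (dotpC y e) (dotpC e u) su sy !expr2; congr (_ <= _); ring.
Qed.

(** The angles of [u] and [y] with [e] are at most pi/2 - r and r, and so add up to at most a right
    angle. *)
Lemma dotp_ge0_of_angles u e y (r : R) : sphere u -> sphere e -> sphere y ->
  0 <= r <= pi / 2 -> sin r <= dotp u e -> cos r <= dotp e y -> 0 <= dotp u y.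
Proof.
move=> su se sy /andP[r0 r1] h1 h2; have hp := @pihalf_ge1 R.
have s0 : 0 <= sin r by apply: sin_ge0_pi; lra.
have c0 : 0 <= cos r by apply: cos_ge0_pihalf; lra.
have h := spherical_cos_rule su se sy.
have h3 : 1 - dotp u e ^+ 2 <= dotp e y ^+ 2.
  have : cos r ^+ 2 <= dotp e y ^+ 2 by rewrite ler_pXn2r// ?nnegrE// (le_trans c0).
  have : sin r ^+ 2 <= dotp u e ^+ 2 by rewrite ler_pXn2r// ?nnegrE// (le_trans s0).
  by have := cos2Dsin2 r; clear; lra.
have h4 : 1 - dotp e y ^+ 2 <= dotp u e ^+ 2 by clear -h3; lra.
have ue := dotp_sphere_le1 su se; have ey := dotp_sphere_le1 se sy.
have h5 : (dotp u y - dotp u e * dotp e y) ^+ 2 <= (dotp u e * dotp e y) ^+ 2.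
  apply: (le_trans h); rewrite exprMn mulrC ler_pM//; rewrite subr_ge0.
    by move: ey => /andP[]; rewrite expr2; clear; nra.
  by move: ue => /andP[]; rewrite expr2; clear; nra.
have p0 : 0 <= dotp u e * dotp e y by rewrite mulr_ge0 ?(le_trans s0 h1) ?(le_trans c0 h2).
by clear -h5 p0; rewrite !expr2 in h5; nra.
Qed.

End CauchySchwarz.

Section Margin.
Context {R : realType} {m : nat}.
Local Notation n := m.+2.
Implicit Types (x y e p q : 'rV[R]_n) (X : seq 'rV[R]_n).

(* The sine of the distance from [e] to the boundary of the cell (with value
   [1] for the empty configuration). *)
Definition margin p X e : R :=
  \big[Order.min/1]_(x <- X) (Num.sg (dotp x p) * dotp x e).

Lemma margin_geP p X e c :
  c <= margin p X e <->
  c <= 1 /\ forall x, x \in X -> c <= Num.sg (dotp x p) * dotp x e.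
Proof.
rewrite /margin; elim: X => [|x X IH].
  by rewrite big_nil; split=> [h|[]//].
rewrite big_cons le_min; split=> [/andP[h1 /IH[h2 h3]]|[h1 h2]].
  by split=> // z; rewrite inE => /predU1P[->//|]; exact: h3.
rewrite h2 ?mem_head//=; apply/IH; split=> // z zX; apply: h2.
by rewrite inE zX orbT.
Qed.

Lemma margin_le1 p X e : margin p X e <= 1.
Proof. by have [] := (margin_geP p X e (margin p X e)).1 (lexx _). Qed.

Lemma margin_le p X e x : x \in X -> margin p X e <= Num.sg (dotp x p) * dotp x e.
Proof. by have [_] := (margin_geP p X e (margin p X e)).1 (lexx _); exact. Qed.

Lemma continuous_margin p X : continuous (margin p X).
Proof.
elim: X => [|x X IH] e.
  rewrite (_ : margin p [::] = fun=> 1); first exact: cst_continuous.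
  by apply/funext => y; rewrite /margin big_nil.
rewrite (_ : margin p (x :: X) =
    (fun y => Num.sg (dotp x p) * dotp x y) \min margin p X); last first.
  by apply/funext => y; rewrite /margin big_cons.
by apply: continuous_min; [exact: continuous_scale_dotp|exact: IH].
Qed.

Lemma margin_gt0_off p X : sphere p -> off_planes p X -> 0 < margin p X p.
Proof.
rewrite /margin => sp; elim: X => [|x X IH] op; first by rewrite big_nil.
rewrite big_cons lt_min sg_mul_dotp_gt0 ?op ?mem_head//= IH// => z zX.
by apply: op; rewrite inE zX orbT.
Qed.

Lemma sphere_nonempty : (@sphere R n) !=set0.
Proof.
exists (unitv (delta_mx 0 0)); apply: sphere_unitv.
by apply/eqP => /rowP/(_ 0); rewrite !mxE eqxx => /eqP; rewrite oner_eq0.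
Qed.

Lemma margin_max p X : exists2 e, sphere e &
  forall e', sphere e' -> margin p X e' <= margin p X e.
Proof.
have [|e /set_mem se he] := @EVT_max_rV R n (margin p X) _ sphere_nonempty
  (@compact_sphere R n).
  by apply: continuous_subspaceT; exact: continuous_margin.
by exists e => // e' se'; apply: he; exact/mem_set.
Qed.

Lemma margin_attained p X e : (forall x, x \in X -> sphere x) ->
  off_planes p X -> X <> [::] -> sphere e ->
  exists2 x, x \in X & Num.sg (dotp x p) * dotp x e = margin p X e.
Proof.
move=> sX op X0 se.
have [h|//] : margin p X e = 1 \/
    exists2 x, x \in X & Num.sg (dotp x p) * dotp x e = margin p X e.
  rewrite /margin; elim: X {sX op X0} => [|x X IH]; first by left; rewrite big_nil.
  rewrite big_cons minEle; case: ifP => _.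
    by right; exists x => //; exact: mem_head.
  case: IH => [->|[z zX zE]]; first by left.
  by right; exists z => //; rewrite inE zX orbT.
(* If the minimum is the default 1, any point attains it, since a dot product of unit vectors is at
   most 1. *)
case: X X0 sX op h => [//|x X] _ sX op h; have xX := mem_head x X.
exists x => //; apply/eqP; rewrite eq_le margin_le// andbT h.
have : sphere (Num.sg (dotp x p) *: x).
  by rewrite /sphere/= !dotpE (sX x xX) mulr1 -expr2 sqr_sg op.
by move=> /dotp_sphere_le1/(_ se)/andP[_]; rewrite dotpZl.
Qed.

Lemma sphere_decomposition (u e : 'rV[R]_n) : sphere u -> sphere e ->
  exists2 g, sphere g &
    dotp u g = 0 /\ e = dotp u e *: u + Num.sqrt (1 - dotp u e ^+ 2) *: g.
Proof.
move=> su se; set c := dotp u e.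
have d : dotp (e - c *: u) (e - c *: u) = 1 - c ^+ 2.
  by rewrite !dotpE (dotpC e u) su se -/c; ring.
have [h|h] := eqVneq (e - c *: u) 0.
  have [g sg ug] := exists_orthogonal su; exists g => //; split=> //.
  by rewrite -d h dotp0l sqrtr0 scale0r addr0; apply/eqP; rewrite -subr_eq0 h.
exists (unitv (e - c *: u)); first exact: sphere_unitv.
split; last by rewrite -d -unitvE addrC subrK.
rewrite /unitv dotpZr (_ : dotp u (e - c *: u) = 0) ?mulr0//.
by rewrite dotpBr dotpZr su mulr1 subrr.
Qed.

Lemma closed_cellP p X e : closed_cell p X e <-> sphere e /\ 0 <= margin p X e.
Proof.
split=> [[se h]|[se /margin_geP[_ h]]]; split=> //.
by apply/margin_geP; split.
Qed.

(* The two directions compare the ball with the hemispheres; beyond the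
   distance [asin] of the margin the ball crosses the hypersphere of a point
   where the minimum is attained. *)
Lemma geod_ball_sub_cell p X e r : (forall x, x \in X -> sphere x) ->
  off_planes p X -> X <> [::] -> closed_cell p X e -> 0 <= r ->
  geod_ball e r `<=` closed_cell p X <-> r <= asin (margin p X e).
Proof.
move=> sX op X0 /closed_cellP[se m0] r0.
have m1 := margin_le1 p X e; set mu := margin p X e in m0 m1 *.
have mu1 : -1 <= mu <= 1 by rewrite m1 andbT; lra.
have smu : sin (asin mu) = mu by rewrite asinK// in_itv.
have as1 : asin mu <= pi / 2 by rewrite asin_lepi2.
have hp1 := @pihalf_ge1 R; have hp2 := @pihalf_lt2 R.
have su x : x \in X -> sphere (Num.sg (dotp x p) *: x).
  by move=> xX; rewrite /sphere/= !dotpE (sX x xX) mulr1 -expr2 sqr_sg op.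
split=> [hb|hr y [sy hy]]; last first.
  split=> // x xX; rewrite -dotpZl.
  apply: (dotp_ge0_of_angles (su x xX) se sy (r := r)).
  - by rewrite r0 (le_trans hr).
  - rewrite dotpZl; apply: le_trans (margin_le p e xX).
    by rewrite -/mu -smu; apply: le_sin.
  - have ey := dotp_sphere_le1 se sy.
    rewrite -[dotp e y](@acosK R) ?in_itv//= leNgt; apply/negP.
    rewrite ltr_cos ?in_itv/= ?acos_ge0 ?acos_lepi//; last by rewrite r0/=; lra.
    by rewrite ltNge => /negP.
rewrite leNgt; apply/negP => rmu.
have as0 : 0 <= asin mu.
  rewrite leNgt; apply/negP => h.
  have : sin (asin mu) < 0.
    by rewrite -sin0 ltr_sin ?in_itv/=; [|have := asin_geNpi2 mu1|]; lra.
  by rewrite smu; lra.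
have [x xX xmu] : exists2 x, x \in X & Num.sg (dotp x p) * dotp x e = mu.
  exact: margin_attained.
have [u uE] : exists u, u = Num.sg (dotp x p) *: x by eexists.
have sux : sphere u by rewrite uE; exact: su.
have ue : dotp u e = mu by rewrite uE dotpZl.
have [g sg [ug eE]] : exists2 g, sphere g &
    dotp u g = 0 /\ e = sin (asin mu) *: u + cos (asin mu) *: g.
  by rewrite smu cos_asin// -ue; exact: sphere_decomposition.
pose b := Num.min (r - asin mu) (pi / 2).
have b0 : 0 < b by rewrite lt_min subr_gt0 rmu; lra.
have b1 : b <= pi / 2 by rewrite ge_min lexx orbT.
have b2 : b <= r - asin mu by rewrite ge_min lexx.
pose y := cos b *: g - sin b *: u.
have sy : sphere y.
  rewrite /sphere/= /y !dotpE sg sux ug (dotpC g u) ug.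
  by rewrite -[RHS](cos2Dsin2 b); ring.
have ey : dotp e y = cos (asin mu + b).
  by rewrite {1}eE /y !dotpE sg sux ug (dotpC g u) ug cosD; ring.
have [_ /(_ x xX)] : closed_cell p X y.
  apply: hb; split=> //=; rewrite /geod_dist ey cosK; first lra.
  by rewrite in_itv/=; lra.
rewrite -dotpZl -uE /y !dotpE ug sux.
have : 0 < sin b by apply: sin_gt0_pi; lra.
by lra.
Qed.

End Margin.

Section Events.
Context {R : realType} {m : nat}.
Local Notation n := m.+2.
Implicit Types (x y e p q : 'rV[R]_n) (X : seq 'rV[R]_n).

Lemma le_asin (s t : R) : -1 <= s -> s <= t -> t <= 1 -> asin s <= asin t.
Proof.
move=> s1 st t1; rewrite leNgt; apply/negP => h.
have s2 : -1 <= s <= 1 by rewrite s1 (le_trans st).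
have t2 : -1 <= t <= 1 by rewrite t1 (le_trans s1).
move: st; rewrite -[s]asinK ?in_itv// -[t]asinK ?in_itv// leNgt ltr_sin ?h//;
  by rewrite in_itv/= asin_geNpi2//= asin_lepi2.
Qed.

Lemma le_acos (s t : R) : -1 <= s -> s <= t -> t <= 1 -> acos t <= acos s.
Proof.
move=> s1 st t1; rewrite leNgt; apply/negP => h.
have s2 : -1 <= s <= 1 by rewrite s1 (le_trans st).
have t2 : -1 <= t <= 1 by rewrite t1 (le_trans s1).
move: st; rewrite -[s]acosK ?in_itv// -[t]acosK ?in_itv// leNgt ltr_cos ?h//;
  by rewrite in_itv/= acos_ge0//= acos_lepi.
Qed.

Lemma compact_closed_cell p X : compact (closed_cell p X).
Proof.
apply: subclosed_compact (@compact_sphere R n) _; first exact: closed_closed_cell.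
by move=> y [].
Qed.

Lemma inradius_atE p X e : (forall x, x \in X -> sphere x) ->
  off_planes p X -> X <> [::] -> closed_cell p X e ->
  inradius_at (closed_cell p X) e = (asin (margin p X e))%:E.
Proof.
move=> sX op X0 Ke; have [se m0] := (closed_cellP p X e).1 Ke.
have m1 := margin_le1 p X e.
have as0 : 0 <= asin (margin p X e).
  by rewrite -[0](@sinK R) ?sin0 ?le_asin// in_itv/=; have := @pi_ge0 R; lra.
apply/eqP; rewrite eq_le; apply/andP; split.
  apply: ge_ereal_sup => _ [r [r0 hr] <-]; rewrite lee_fin.
  exact/(geod_ball_sub_cell sX op X0 Ke r0).
apply: ereal_sup_ubound; exists (asin (margin p X e)) => //; split=> //.
exact/(geod_ball_sub_cell sX op X0 Ke as0).
Qed.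

Lemma inradius_at_sphere p e : inradius_at (closed_cell p [::]) e = +oo%E.
Proof.
rewrite /inradius_at; apply/eqP; rewrite -leye_eq leNgt; apply/negP => h.
set s := ereal_sup _ in h.
have s0 : (0%:E <= s)%E.
  by apply: ereal_sup_ubound; exists 0 => //; split=> // y [].
have fs : s \is a fin_num by rewrite ge0_fin_numE.
have : ((fine s + 1)%:E <= s)%E.
  apply: ereal_sup_ubound; exists (fine s + 1) => //; split.
    by rewrite addr_ge0// fine_ge0.
  by move=> y [].
by rewrite -[X in (_ <= X)%E](fineK fs) lee_fin; lra.
Qed.

Lemma inradius_max p X e : sphere p -> (forall x, x \in X -> sphere x) ->
  off_planes p X -> X <> [::] -> sphere e ->
  (forall e', sphere e' -> margin p X e' <= margin p X e) ->
  closed_cell p X e /\ inradius (closed_cell p X) = (asin (margin p X e))%:E.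
Proof.
move=> sp sX op X0 se emax.
have Ke : closed_cell p X e.
  by apply/closed_cellP; split=> //; rewrite (le_trans _ (emax p sp))// ltW// margin_gt0_off.
split=> //; apply/eqP; rewrite eq_le; apply/andP; split.
  apply: ge_ereal_sup => _ [e' Ke' <-]; rewrite inradius_atE// lee_fin.
  have [se' m0] := (closed_cellP p X e').1 Ke'.
  by apply: le_asin; [lra|exact: emax|exact: margin_le1].
by apply: ereal_sup_ubound; exists e => //; rewrite inradius_atE.
Qed.

Lemma crofton_cell_onE p X : sphere p -> ~ off_planes p X -> crofton_cell p X = set0.
Proof.
move=> sp nop; apply: xgetPN => Z h; apply: nop.
by have [] := (crofton_cellE X Z sp).1 h.
Qed.

Lemma crofton_cell_offE p X : sphere p -> off_planes p X ->
  crofton_cell p X = closed_cell p X.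
Proof.
move=> sp op; apply: xget_unique; first exact/crofton_cellE.
by move=> Z /(crofton_cellE X Z sp)[].
Qed.

Lemma crofton_inradius_ge p X a : sphere p -> (forall x, x \in X -> sphere x) ->
  0 < a < pi / 2 ->
  (a%:E <= inradius (crofton_cell p X))%E <->
  off_planes p X /\ exists2 e, sphere e & sin a <= margin p X e.
Proof.
move=> sp sX /andP[a0 a1]; have hp1 := @pihalf_ge1 R.
have [op|op] := pselect (off_planes p X); last first.
  rewrite crofton_cell_onE// /inradius image_set0 ereal_sup0.
  by split=> [|[]//]; rewrite leeNy_eq.
rewrite crofton_cell_offE//; case: (pselect (X = [::])) => [->|X0].
  split=> _.
    split; first by move=> x.
    by exists p => //; apply/margin_geP; split=> //; exact: sin_le1.
  rewrite (_ : inradius _ = +oo%E) ?leey//; apply/eqP; rewrite -leye_eq.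
  by apply: ereal_sup_ubound; exists p; [split|exact: inradius_at_sphere].
have [e se emax] := margin_max p X.
have [Ke ->] := inradius_max sp sX op X0 se emax.
have m0 : 0 < margin p X e by apply: lt_le_trans (emax p sp); exact: margin_gt0_off.
have m1 := margin_le1 p X e.
have aK : asin (sin a) = a by rewrite sinK// in_itv/=; lra.
rewrite lee_fin; split=> [h|[_ [e' se' he']]].
  split=> //; exists e => //; rewrite -[margin p X e]asinK ?in_itv/=; last by lra.
  by apply: le_sin; rewrite ?asin_lepi2//; lra.
rewrite -aK; apply: le_asin => //; first exact: sin_geN1.
exact: le_trans (emax _ se').
Qed.

(** The normalized midpoint has margin at least 2 M / |e + e'|. Maximality forces |e + e'| >= 2,
    which for unit vectors means equality of the two. *)
Lemma incenter_unique p X e e' : (forall x, x \in X -> sphere x) -> X <> [::] ->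
  sphere e -> sphere e' -> 0 < margin p X e -> margin p X e <= margin p X e' ->
  (forall e', sphere e' -> margin p X e' <= margin p X e) -> e' = e.
Proof.
move=> sX X0 se se' m0 mm emax.
case: X X0 sX m0 mm emax => [//|x0 X] _ sX m0 mm emax.
set M := margin _ _ _ in m0 mm emax *.
have he x : x \in x0 :: X -> 2 * M <= Num.sg (dotp x p) * dotp x (e + e').
  move=> xX; rewrite dotpDr mulrDr.
  have h1 : M <= Num.sg (dotp x p) * dotp x e := margin_le p e xX.
  have h2 := le_trans mm (margin_le p e' xX).
  by clear -h1 h2; lra.
have s0 : e + e' != 0.
  apply/eqP => h; have := he x0 (mem_head _ _).
  by rewrite h dotp0r mulr0; clear -m0; lra.
have N0 := sqrt_dotp_gt0 s0.
set N := Num.sqrt _ in N0.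
have N2 : N ^+ 2 = 2 + 2 * dotp e e'.
  by rewrite sqr_sqrt_dotp !dotpE se se' (dotpC e' e); ring.
have Nle2 : 2 <= N.
  rewrite leNgt; apply/negP => N2'.
  have : 2 * M / N <= margin p (x0 :: X) (unitv (e + e')).
    have h x : x \in x0 :: X -> 2 * M / N <= Num.sg (dotp x p) * dotp x (unitv (e + e')).
      move=> xX; rewrite /unitv dotpZr mulrCA mulrC ler_pM2l ?invr_gt0//; exact: he.
    apply/margin_geP; split=> //; apply: (le_trans (h x0 (mem_head _ _))).
    have := dotp_sphere_le1 (sX x0 (mem_head _ _)) (sphere_unitv s0).
    rewrite -ler_norml => h1; rewrite (le_trans (ler_norm _))// normrM.
    by rewrite -[1]mulr1 ler_pM// normr_sg lern1 leq_b1.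
  move/le_trans => /(_ _ (emax _ (sphere_unitv s0))).
  by rewrite ler_pdivrMr// (mulrC 2) ler_pM2l// leNgt N2'.
apply/eqP; rewrite -subr_eq0 -dotp_eq0; apply/eqP/le_anti; rewrite dotp_ge0 andbT.
rewrite !dotpE se se' (dotpC e' e).
by have : 4 <= N ^+ 2; [rewrite expr2; clear -Nle2; nra|rewrite N2; clear; lra].
Qed.

Lemma closed_cell_body p X e : sphere p -> (forall x, x \in X -> sphere x) ->
  X <> [::] -> sphere e -> 0 < margin p X e ->
  spherically_convex_body (closed_cell p X).
Proof.
move=> sp sX X0 se m0.
pose C : set 'rV[R]_n := [set y | forall x, x \in X -> 0 <= Num.sg (dotp x p) * dotp x y].
exists C; split=> //.
- split.
  + by exists 0 => x xX; rewrite dotp0r mulr0.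
  + rewrite (_ : C = \bigcap_(x in [set` X])
      (fun y => Num.sg (dotp x p) * dotp x y) @^-1` [set t : R | 0 <= t]); last first.
      by apply/seteqP; split=> y h x /=; exact: h.
    apply: closed_bigI => x _; apply: preimage_closed; last exact: closed_ge.
    by move=> y _; exact: continuous_scale_dotp.
  + move=> y z t /set_mem hy /set_mem hz; apply/mem_set => x xX.
    have h1 : 0 <= t%:num by exact: ge0.
    have h2 : 0 <= 1 - t%:num by rewrite subr_ge0; exact: le1.
    rewrite [conv _ _ _](_ : _ = t%:num *: (y : 'rV[R]_n) + (1 - t%:num) *: (z : 'rV[R]_n))//.
    by rewrite !dotpE mulrDr addr_ge0// mulrCA mulr_ge0//; [exact: hy|exact: hz].
  + by move=> t y t0 hy x xX; rewrite dotpZr mulrCA mulr_ge0// hy.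
(* A subspace would contain - [e] along with [e], where the positive forms of the nonempty
   configuration turn negative. *)
- move=> [V VE].
  have eV : e \in V.
    have : C e by move=> x xX; rewrite (le_trans _ (margin_le p e xX))// ltW.
    by rewrite VE.
  have : C (- e) by rewrite VE /= memvN.
  have [x xX] : exists x, x \in X.
    by clear -X0; case: X X0 => [//|x X] _; exists x; exact: mem_head.
  move=> /(_ x xX); have := margin_le p e xX.
  by rewrite dotpNr mulrN; clear -m0; lra.
Qed.

Lemma sphere_not_body : ~ spherically_convex_body (@sphere R n).
Proof.
move=> [C [[C0 _ _ cone] nlin SE]]; apply: nlin; exists fullv.
apply/seteqP; split=> y _ /=; first by rewrite memvf.
have [->|y0] := eqVneq y 0.
  by have [z Cz] := C0; rewrite -(scale0r z); exact: cone.
rewrite [y]unitvE; apply: cone; first exact: sqrtr_ge0.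
by have : sphere (unitv y) by [exact: sphere_unitv]; rewrite SE => -[].
Qed.

(** By [incenter_unique] the infimum runs over [e] alone, and the circumradius at [e] is the angle
    to a farthest point of the cell. The empty configuration drops out because the whole sphere is
    not a spherically convex body. *)
Lemma vartheta_event p X a eps e : sphere p -> (forall x, x \in X -> sphere x) ->
  off_planes p X -> 0 < a < pi / 2 -> 0 < eps <= 1 ->
  sphere e -> (forall e', sphere e' -> margin p X e' <= margin p X e) ->
  sin a <= margin p X e ->
  (spherically_convex_body (closed_cell p X) /\
   (eps%:E <= vartheta_r (closed_cell p X))%E) <->
  (X <> [::] /\ exists y, [/\ sphere y, 0 <= margin p X y &
     dotp e y <= cos (asin (margin p X e) + eps)]).
Proof.
move=> sp sX op /andP[a0 a1] /andP[e0 e1] se emax ma.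
have hp1 := @pihalf_ge1 R.
have sa0 : 0 < sin a by apply: sin_gt0_pi; lra.
have M0 := lt_le_trans sa0 ma; have M1 := margin_le1 p X e.
set M := margin p X e in ma emax M0 M1 *.
have M11 : -1 <= M <= 1 by lra.
have asM1 : asin M <= pi / 2 by rewrite asin_lepi2.
have asM0 : 0 <= asin M.
  by rewrite -[0](@sinK R) ?sin0 ?le_asin// ?in_itv/=; lra.
(* On this range the cosine is decreasing; eps <= 1 <= pi/2 keeps the sum inside. *)
have inpi : 0 <= asin M + eps <= pi by lra.
split.
  move=> [body veps]; have X0 : X <> [::].
    move=> X0; apply: sphere_not_body; move: body; rewrite X0.
    by congr spherically_convex_body; apply/seteqP; split=> [y []|y sy]//; split.
  split=> //; have [Ke inrE] := inradius_max sp sX op X0 se emax.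
  have [|y /set_mem Ky ymin] := @EVT_min_rV R n (dotp e) (closed_cell p X)
      (ex_intro _ e Ke) (@compact_closed_cell p X).
    by apply: continuous_subspaceT; exact: continuous_dotp.
  have [sy my] := (closed_cellP p X y).1 Ky.
  exists y; split=> //.
  have ey := dotp_sphere_le1 se sy.
  have circ : (circumradius_at (closed_cell p X) e <= (acos (dotp e y))%:E)%E.
    apply: ereal_inf_lbound; exists (acos (dotp e y)) => //; split.
      by rewrite acos_ge0.
    move=> z Kz; have [sz _] := (closed_cellP p X z).1 Kz; split=> //=.
    apply: le_acos; [by case/andP: ey|exact/ymin/mem_set|].
    by have /andP[] := dotp_sphere_le1 se sz.
  have : (eps%:E <= (acos (dotp e y))%:E - (asin M)%:E)%E.
    apply: (le_trans veps).
    apply: (@le_trans _ _ (circumradius_at (closed_cell p X) e -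
        inradius_at (closed_cell p X) e)%E).
      apply: ereal_inf_lbound; exists e => //; split=> //.
      by rewrite inradius_atE// inrE.
    by rewrite inradius_atE//; exact: leeB.
  rewrite -EFinB lee_fin => h.
  rewrite -[leLHS]acosK ?in_itv//= leNgt; apply/negP.
  rewrite ltr_cos ?in_itv/= ?acos_ge0 ?acos_lepi//.
  by clear -h; lra.
move=> [X0 [y [sy my ey]]]; split; first exact: (closed_cell_body sp sX X0 se M0).
have [Ke inrE] := inradius_max sp sX op X0 se emax.
apply: le_ereal_inf_tmp => _ [e' [Ke' ie'] <-].
have [se' m'] := (closed_cellP p X e').1 Ke'.
have ee' : e' = e.
  apply: (incenter_unique sX X0 se se' M0 _ emax).
  move: ie'; rewrite inrE inradius_atE// => -[h].
  rewrite -/M -(@asinK R M) ?in_itv//= -h asinK ?in_itv//=.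
  by have := margin_le1 p X e'; lra.
rewrite ee' inradius_atE// -/M.
have : (((asin M) + eps)%:E <= circumradius_at (closed_cell p X) e)%E.
  apply: le_ereal_inf_tmp => _ [r [r0 hr] <-]; rewrite lee_fin.
  have [_ /= yr] := hr y ((closed_cellP p X y).2 (conj sy my)).
  apply: le_trans yr; rewrite /geod_dist leNgt; apply/negP => h.
  have ey1 := dotp_sphere_le1 se sy.
  move: ey; rewrite -[leLHS]acosK ?in_itv//= leNgt ltr_cos ?h// in_itv/= ?acos_ge0 ?acos_lepi//.
by rewrite EFinD addeC -leeBrDr.
Qed.

End Events.

(** * Measurability of the events *)

Section MeasurableExists.
Context {R : realType} d (T : measurableType d) (V : topologicalType).

(** A point with F >= 0 may be missed by the dense family. Values at least -1/(k+1) for every k are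
    not missed, and they force the maximum, which exists by compactness, to be nonnegative. *)
Lemma measurable_exists_compact (I : countType) (dns : I -> V) (S : set V)
    (F : T -> V -> R) :
  compact S -> (forall i, S (dns i)) ->
  (forall e U, S e -> nbhs e U -> exists i, U (dns i)) ->
  (forall w, continuous (F w)) ->
  (forall e, measurable_fun setT (fun w => F w e)) ->
  measurable [set w | exists2 e, S e & 0 <= F w e].
Proof.
move=> cS Sd dense cF mF.
rewrite (_ : [set w | _] =
    \bigcap_(k : nat) \bigcup_i [set w | - k.+1%:R^-1 <= F w (dns i)]).
  apply: bigcap_measurableType => k _.
  apply: countable_bigcupT_measurable; first exact: countableP.
  by move=> i; have := measurable_fun_le measurableT
    (measurable_cst (- k.+1%:R^-1 : R)) (mF (dns i)); rewrite setTI.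
apply/seteqP; split=> w.
  move=> [e Se Fe] k _.
  have k0 : - k.+1%:R^-1 < F w e by rewrite (lt_le_trans _ Fe)// oppr_lt0 invr_gt0.
  have [i hi] := dense e _ Se (cvgr_gt _ (cF w e) _ k0).
  by exists i => //; exact: ltW.
move=> h; have [i0 _ _] := h 0 Logic.I.
have [|e /set_mem Se emax] := compact_EVT_max (ex_intro _ _ (Sd i0)) cS (f := F w).
  by apply: continuous_subspaceT; exact: cF.
exists e => //; rewrite leNgt; apply/negP => Fe.
pose k := Num.truncn (- F w e)^-1.
have [i _ hi] := h k Logic.I.
have := le_trans hi (emax _ (mem_set (Sd i))).
rewrite leNgt => /negP; apply; rewrite ltrNr.
by rewrite -[X in _ < X]invrK ltf_pV2 ?posrE ?invr_gt0 ?oppr_gt0// truncnS_gt.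
Qed.

End MeasurableExists.

Section DenseSphere.
Context {R : realType} {m : nat}.
Local Notation n := m.+2.

Definition rational_direction (q : {ffun 'I_n -> rat}) : 'rV[R]_n :=
  let v := \row_i ratr (q i) in
  if v == 0 then unitv (delta_mx 0 0) else unitv v.

Lemma sphere_rational_direction q : sphere (rational_direction q).
Proof.
rewrite /rational_direction; case: ifPn => [_|]; last exact: sphere_unitv.
apply: sphere_unitv.
by apply/eqP => /rowP/(_ 0); rewrite !mxE eqxx => /eqP; rewrite oner_eq0.
Qed.

Lemma dense_rational_direction (e : 'rV[R]_n) (U : set 'rV[R]_n) :
  sphere e -> nbhs e U -> exists q, U (rational_direction q).
Proof.
move=> se Ue.
have e0 : e != 0 := sphere_neq0 se.
have : \forall v \near e, U (unitv v).
  have := cvg_unitv e0 (@cvg_id _ (nbhs e)); rewrite (unitv_id se); exact.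
have nz : \forall v \near e, 0 < dotp v v.
  have cv : dotp v v @[v --> e] --> dotp e e by
    apply: (@cvg_dotp _ _ _ (nbhs e) _ id id); exact: cvg_id.
  by apply: (cvgr_gt _ cv); rewrite se ltr01.
move=> /(filterI nz)/nbhs_ballP[r /= r0 hr].
have hq i : exists q : rat, `|e 0 i - ratr q| < r.
  have [|q] := @rat_in_itvoo R (e 0 i - r) (e 0 i + r).
    by rewrite ltrD2l gtrN.
  rewrite in_itv/= => /andP[h1 h2]; exists q.
  by rewrite ltr_distlC h1 h2.
pose q : {ffun 'I_n -> rat} := [ffun i => sval (cid (hq i))].
have /hr[v0 Uv] : ball e r (\row_i ratr (q i)).
  split=> // i j; rewrite ord1 mxE /q ffunE.
  by case: cid => z /= hz; rewrite -ball_normE.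
exists q; rewrite /rational_direction ifN// -dotp_eq0 gt_eqF//.
Qed.

End DenseSphere.

Section ConfigurationEvents.
Context {R : realType} {m : nat} {disp : measure_display} {T : measurableType disp}.
Local Notation n := m.+2.
Variable X : T -> seq 'rV[R]_n.
Hypothesis mX : forall A, borel A -> measurable_fun [set: T] (num_points X A).

(** Void events: the measurability of the events and the probabilities below are reduced to
    these. *)
Lemma num_points_eq0 (A : set 'rV[R]_n) :
  num_points X A @^-1` [set 0%N] = [set w | forall x, x \in X w -> ~ A x].
Proof.
apply/seteqP; split=> w; rewrite /num_points /=.
  move=> h x xX Ax; have : has (fun x => x \in A) (X w).
    by apply/hasP; exists x => //; exact/mem_set.
  by rewrite has_count h.
move=> h; apply/eqP; rewrite -leqn0 leqNgt -has_count; apply/hasP => -[x xX /set_mem].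
exact: h.
Qed.

Lemma measurable_forall_points (Q : set 'rV[R]_n) : borel Q ->
  measurable [set w | forall x, x \in X w -> Q x].
Proof.
move=> bQ; have bC : borel (~` Q) by exact: (@measurableC _ (rVb R n)).
have := mX bC measurableT (Y := [set 0%N]) Logic.I.
rewrite setTI num_points_eq0; congr measurable; apply/seteqP; split=> w /= h x xX.
  by apply: contrapT; exact: h.
by move/(_ (h x xX)).
Qed.

Lemma measurable_sg (p : 'rV[R]_n) :
  measurable_fun [set: rVb R n] (fun x => Num.sg (dotp x p)).
Proof.
have md : measurable_fun [set: rVb R n] (fun x => dotp x p) by exact: measurable_dotp.
rewrite (_ : (fun _ => _) = (fun x : rVb R n => if 0 < dotp x p then 1
    else if dotp x p < 0 then -1 else 0)); last first.
  by apply/funext => x; case: ltgtP => [/gtr0_sg|/ltr0_sg|<-] //; rewrite sgr0.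
apply: measurable_fun_ifT => //; first exact: measurable_fun_ltr.
by apply: measurable_fun_ifT => //; exact: measurable_fun_ltr.
Qed.

Lemma borel_sg_dotp_ge (p e : 'rV[R]_n) (c : R) :
  borel [set x | c <= Num.sg (dotp x p) * dotp x e].
Proof.
apply: borel_le => //; apply: measurable_funM; first exact: measurable_sg.
exact: measurable_dotp.
Qed.

Lemma borel_off (p : 'rV[R]_n) : borel [set x | dotp x p != 0].
Proof.
have md : measurable_fun [set: rVb R n] (fun x => dotp x p) by exact: measurable_dotp.
have m0 : measurable_fun [set: rVb R n] (fun=> 0 : R) by exact: measurable_cst.
have := @measurableU _ (rVb R n) _ _ (borel_lt md m0) (borel_lt m0 md).
congr borel; apply/seteqP; split=> x /=; rewrite neq_lt => /orP; exact.
Qed.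

Lemma measurable_off_planes p : measurable [set w | off_planes p (X w)].
Proof. exact: measurable_forall_points (borel_off p). Qed.

Lemma measurable_nonempty : measurable [set w | X w <> [::]].
Proof.
have bT : borel (@setT 'rV[R]_n) by exact: (@measurableT _ (rVb R n)).
have := measurableC (mX bT measurableT (Y := [set 0%N]) Logic.I).
rewrite setTI num_points_eq0; congr measurable; apply/seteqP; split=> w /=.
  by move=> h Xw; apply: h => x; rewrite Xw.
by case: (X w) => [//|x s] _ /(_ x (mem_head _ _)); exact.
Qed.

Lemma measurable_fun_geP (f : T -> R) :
  (forall c, measurable [set w | c <= f w]) -> measurable_fun setT f.
Proof.
move=> mf; apply: (measurability _ (RGenCInfty.measurableE R)).
move=> _ [_ [c ->] <-]; rewrite setTI; have := mf c.
by congr measurable; apply/seteqP; split=> w /=; rewrite in_itv/= andbT.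
Qed.

Lemma measurable_margin p e : measurable_fun setT (fun w => margin p (X w) e).
Proof.
apply: measurable_fun_geP => c; have [c1|c1] := leP c 1.
  have := measurable_forall_points (borel_sg_dotp_ge p e c).
  congr measurable; apply/seteqP; split=> w /=; first by move=> h; apply/margin_geP.
  by move/margin_geP=> [].
rewrite (_ : [set w | _] = set0)//; apply/seteqP; split=> w //=.
by move/margin_geP => [+ _]; rewrite leNgt c1.
Qed.

Definition max_margin p (s : seq 'rV[R]_n) : R :=
  margin p s (s2val (cid2 (margin_max p s))).

Lemma le_max_margin p s e : sphere e -> margin p s e <= max_margin p s.
Proof. by rewrite /max_margin; case: cid2 => /= e0 _; exact. Qed.

Lemma max_marginP p s : exists2 e, sphere e & margin p s e = max_margin p s.
Proof. by rewrite /max_margin; case: cid2 => /= e0 se0 _; exists e0. Qed.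

Lemma measurable_max_margin p : measurable_fun setT (fun w => max_margin p (X w)).
Proof.
apply: measurable_fun_geP => c.
have := @measurable_exists_compact R _ T _ _ (@rational_direction R m) sphere
  (fun w e => margin p (X w) e - c) (@compact_sphere R n)
  (@sphere_rational_direction R m) (@dense_rational_direction R m).
have cF w : continuous (fun e => margin p (X w) e - c).
  move=> e; apply: (@cvgB _ _ _ (nbhs e) _ (margin p (X w)) (fun=> c)).
    exact: continuous_margin.
  exact: cvg_cst.
have mF e : measurable_fun setT (fun w => margin p (X w) e - c).
  by apply: measurable_funB => //; exact: measurable_margin.
move=> /(_ cF mF); congr measurable; apply/seteqP; split=> w /=.
  by move=> [e se]; rewrite subr_ge0 => h; apply: le_trans h (le_max_margin _ _ se).
by have [e se <-] := max_marginP p (X w) => h; exists e; rewrite // subr_ge0.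
Qed.

End ConfigurationEvents.

Section CroftonEvents.
Context {R : realType} {m : nat}.
Local Notation n := m.+2.
Implicit Types (x y e p q : 'rV[R]_n) (s : seq 'rV[R]_n).

(* [cos (asin M + eps)] as a function that is continuous on the whole line. *)
Definition far_bound (eps M : R) : R :=
  Num.sqrt (1 - M ^+ 2) * cos eps - M * sin eps.

Lemma far_boundE eps M : -1 <= M <= 1 -> far_bound eps M = cos (asin M + eps).
Proof. by move=> hM; rewrite cosD cos_asin// asinK ?in_itv. Qed.

Lemma measurable_far_bound eps : measurable_fun [set: R] (far_bound eps).
Proof.
apply: continuous_measurable_fun => M.
apply: (@cvgB _ _ _ (nbhs M)).
  apply: (@cvgMr_tmp _ _ (nbhs M)).
  apply: continuous_cvg; first exact: sqrt_continuous.
  apply: (@cvgB _ _ _ (nbhs M)); first exact: cvg_cst.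
  exact: exprn_continuous.
apply: (@cvgMr_tmp _ _ (nbhs M)); exact: cvg_id.
Qed.

Definition deep_cell p s (a eps : R) :=
  (spherically_convex_body (crofton_cell p s) /\
   (eps%:E <= vartheta_r (crofton_cell p s))%E) /\
  (a%:E <= inradius (crofton_cell p s))%E.

(** Three conditions in one inequality, as [measurable_exists_compact] requires: the first vector is
    an incenter, the second belongs to the cell, and their distance is at least the inradius plus
    eps. *)
Definition far_pair p s eps (ey : 'rV[R]_n * 'rV[R]_n) : R :=
  Order.min (Order.min (margin p s ey.1 - max_margin p s) (margin p s ey.2))
    (far_bound eps (max_margin p s) - dotp ey.1 ey.2).

Lemma inradius_eventP p s a : sphere p -> (forall x, x \in s -> sphere x) ->
  0 < a < pi / 2 -> (a%:E <= inradius (crofton_cell p s))%E <->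
  off_planes p s /\ sin a <= max_margin p s.
Proof.
move=> sp ss a01; rewrite (crofton_inradius_ge sp ss a01).
split=> -[op h]; split=> //.
  by have [e se he] := h; apply: (le_trans he); exact: le_max_margin.
by have [e se he] := max_marginP p s; exists e => //; rewrite he.
Qed.

Lemma deep_cellP p s a eps : sphere p -> (forall x, x \in s -> sphere x) ->
  0 < a < pi / 2 -> 0 < eps <= 1 ->
  deep_cell p s a eps <->
  [/\ off_planes p s, s <> [::], sin a <= max_margin p s &
    exists2 ey, (sphere `*` sphere) ey & 0 <= far_pair p s eps ey].
Proof.
move=> sp ss a01 eps01; have hp1 := @pihalf_ge1 R.
have bound : sin a <= max_margin p s -> -1 <= max_margin p s <= 1.
  have sa0 : 0 < sin a by apply: sin_gt0_pi; clear -a01 hp1; lra.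
  have [e _ <-] := max_marginP p s; rewrite margin_le1 andbT.
  by clear -sa0; lra.
rewrite /deep_cell (inradius_eventP sp ss a01); split.
  move=> [body [op ma]]; have [e se eM] := max_marginP p s.
  have emax e' : sphere e' -> margin p s e' <= margin p s e.
    by rewrite eM; exact: le_max_margin.
  rewrite crofton_cell_offE// in body; rewrite -eM in ma.
  have [s0 [y [sy my ey]]] := (vartheta_event sp ss op a01 eps01 se emax ma).1 body.
  rewrite eM in ma; split=> //.
  exists (e, y) => //=; rewrite /far_pair/= !le_min eM subrr lexx my/=.
  by rewrite far_boundE ?bound// subr_ge0 -eM.
move=> [op s0 ma [[e y] [/= se sy]]].
rewrite /far_pair !le_min/= !subr_ge0 => /andP[/andP[me my] ey].
have eM : margin p s e = max_margin p s.
  by apply/eqP; rewrite eq_le me le_max_margin.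
split=> //; rewrite crofton_cell_offE//.
apply/(vartheta_event sp ss op a01 eps01 se).
- by move=> e' se'; rewrite eM le_max_margin.
- by rewrite eM.
- by split=> //; exists y; split=> //; rewrite eM -far_boundE ?bound.
Qed.

Lemma continuous_far_pair p s eps : continuous (far_pair p s eps).
Proof.
move=> ey; have c1 : (fun z : 'rV[R]_n * 'rV[R]_n => z.1) @ ey --> ey.1 by exact: cvg_fst.
have c2 : (fun z : 'rV[R]_n * 'rV[R]_n => z.2) @ ey --> ey.2 by exact: cvg_snd.
apply: (@continuous_min _ _ (fun z => Order.min (margin p s z.1 - max_margin p s) (margin p s z.2))
  (fun z => far_bound eps (max_margin p s) - dotp z.1 z.2)).
  apply: (@continuous_min _ _ (fun z => margin p s z.1 - max_margin p s)
    (fun z => margin p s z.2)).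
    apply: (@cvgB _ _ _ (nbhs ey)); last exact: cvg_cst.
    by apply: continuous_cvg; [exact: continuous_margin|exact: c1].
  by apply: continuous_cvg; [exact: continuous_margin|exact: c2].
apply: (@cvgB _ _ _ (nbhs ey)); first exact: cvg_cst.
exact: cvg_dotp.
Qed.

Context {disp : measure_display} {T : measurableType disp}.
Variable X : T -> seq 'rV[R]_n.
Hypothesis mX : forall A, borel A -> measurable_fun [set: T] (num_points X A).
Hypothesis sX : forall w x, x \in X w -> sphere x.

Lemma measurable_inradius_event p a : sphere p -> 0 < a < pi / 2 ->
  measurable [set w | (a%:E <= inradius (crofton_cell p (X w)))%E].
Proof.
move=> sp a01.
rewrite (_ : [set w | _] = [set w | off_planes p (X w)] `&`
    [set w | sin a <= max_margin p (X w)]); last first.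
  by apply/seteqP; split=> w /(inradius_eventP sp (sX (w:=w)) a01).
apply: measurableI; first exact: measurable_off_planes.
have := measurable_fun_le measurableT (measurable_cst (sin a))
  (measurable_max_margin mX p).
by rewrite setTI.
Qed.

Lemma measurable_deep_cell p a eps : sphere p -> 0 < a < pi / 2 -> 0 < eps <= 1 ->
  measurable [set w | deep_cell p (X w) a eps].
Proof.
move=> sp a01 eps01.
rewrite (_ : [set w | _] = [set w | off_planes p (X w)] `&` [set w | X w <> [::]] `&`
    [set w | sin a <= max_margin p (X w)] `&`
    [set w | exists2 ey, (sphere `*` sphere) ey & 0 <= far_pair p (X w) eps ey]); last first.
  apply/seteqP; split=> w.
    by move=> /(deep_cellP sp (sX (w:=w)) a01 eps01)[].
  by move=> [[[h1 h2] h3] h4]; apply/(deep_cellP sp (sX (w:=w)) a01 eps01).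
apply: measurableI.
  apply: measurableI.
    by apply: measurableI; [exact: measurable_off_planes|exact: measurable_nonempty].
  have := measurable_fun_le measurableT (measurable_cst (sin a))
    (measurable_max_margin mX p).
  by rewrite setTI.
apply: (@measurable_exists_compact R _ T ('rV[R]_n * 'rV[R]_n)%type
  ({ffun 'I_n -> rat} * {ffun 'I_n -> rat})%type
  (fun q : {ffun 'I_n -> rat} * {ffun 'I_n -> rat} =>
   (@rational_direction R m q.1, @rational_direction R m q.2)) (sphere `*` sphere)
  (fun w => far_pair p (X w) eps)).
- by apply: compact_setX; exact: compact_sphere.
- by move=> q; split; exact: sphere_rational_direction.
- move=> [e y] U [/= se sy] [[U1 U2] [/= nU1 nU2] U12].
  have [q1 h1] := dense_rational_direction se nU1.
  have [q2 h2] := dense_rational_direction sy nU2.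
  by exists (q1, q2); apply: U12.
- by move=> w; exact: continuous_far_pair.
move=> [e y]; rewrite /far_pair/=.
apply: measurable_minr.
  apply: measurable_minr; last exact: measurable_margin.
  by apply: measurable_funB; [exact: measurable_margin|exact: measurable_max_margin].
apply: measurable_funB; last exact: measurable_cst.
by apply: (measurableT_comp (measurable_far_bound eps)); exact: measurable_max_margin.
Qed.

End CroftonEvents.

(** * Hyperspheres hitting a ball or separating a point from it *)

Section Bands.
Context {R : realType} {k : nat}.
Local Notation n := k.+1.
Implicit Types (e p y : 'rV[R]_n) (c : R).

(** On the sphere, with c = sin r and 0 < r < pi/2, these are the poles of the hyperspheres meeting
    the open ball of radius r around [e]. *)
Definition band e c : set 'rV[R]_n := [set x | `|dotp x e| < c].

Lemma borel_band e c : borel (band e c).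
Proof.
apply: borel_lt => //; apply: measurableT_comp => //.
exact: measurable_dotp.
Qed.

Lemma nsm_band e p c : sphere e -> sphere p ->
  normalized_spherical_measure (band e c) = normalized_spherical_measure (band p c).
Proof.
move=> se sp; rewrite -(nsm_reflection (e - p) (borel_band p c)).
congr normalized_spherical_measure; apply/seteqP; split=> x; rewrite /band/preimage/=;
  by rewrite -{2}(reflection_swap (u := e) (v := p)) ?se ?sp// dotp_reflection.
Qed.

(** The strict inequality in [band] makes it the increasing union of narrower bands, so continuity
    from below applies. *)
Lemma nsm_band_left_continuous e c eta : 0 < eta ->
  exists2 delta, 0 < delta & forall t, 0 <= t <= delta ->
   normalized_spherical_measure (band e c) - eta <=
   normalized_spherical_measure (band e (c - t)).
Proof.
move=> eta0; pose A (i : nat) := band e (c - i.+1%:R^-1).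
have mA i : borel (open_cone (A i)) := borel_open_cone (borel_band _ _).
have cupA : \bigcup_i open_cone (A i) = open_cone (band e c).
  apply/seteqP; split=> x.
    move=> [i _ [xb]]; rewrite /A /band /preimage/= => h; split=> //=.
    by apply: (lt_trans h); rewrite gtrBl invr_gt0.
  move=> [xb]; rewrite /band /preimage/= => h.
  pose i := Num.truncn (c - `|dotp (unitv x) e|)^-1.
  exists i => //; split=> //; rewrite /A /band /preimage/= ltrBrDr -ltrBrDl.
  by rewrite -[X in _ < X]invrK ltf_pV2 ?posrE ?invr_gt0 ?subr_gt0// truncnS_gt.
have mcup : borel (\bigcup_i open_cone (A i)).
  by rewrite cupA; exact: borel_open_cone (borel_band _ _).
have nd : nondecreasing_seq (fun i => open_cone (A i)).
  move=> i j ij; apply/subsetPset => x [xb]; rewrite /A /band /preimage/= => h.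
  split=> //=; apply: (lt_le_trans h); rewrite lerD2l lerN2.
  by rewrite lef_pV2 ?posrE// ler_nat.
have := @nondecreasing_cvg_mu _ (rVb R n) R (rVm n) (fun i => open_cone (A i)) mA mcup nd.
rewrite cupA => cv.
have v0 : 0 < ball_volume R k := ball_volume_gt0.
have fin1 : rVm n (open_cone (band e c)) = (fine (rVm n (open_cone (band e c))))%:E.
  by rewrite fineK// rVm_open_cone_fin//; exact: borel_band.
move: cv; rewrite fin1 => /fine_cvg cv.
have lt1 : fine (rVm n (open_cone (band e c))) - eta * ball_volume R k <
    fine (rVm n (open_cone (band e c))) by rewrite gtrBl mulr_gt0.
have := cvgr_gt _ cv _ lt1 => -[i _ /(_ i (leqnn i))/= hi].
exists i.+1%:R^-1; first by rewrite invr_gt0.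
move=> t /andP[t0 ti].
apply: (@le_trans _ _ (normalized_spherical_measure (A i))).
  rewrite !nsmE; [|exact: borel_band|exact: borel_band].
  by rewrite ler_pdivlMr// mulrBl divfK ?gt_eqF// ltW.
apply: nsm_le; [exact: borel_band|exact: borel_band|].
move=> x [h _]; rewrite /A /band/= in h *; apply: (lt_le_trans h).
by rewrite lerD2l lerN2.
Qed.

End Bands.

Section Separation.
Context {R : realType} {k : nat}.
Local Notation n := k.+3.
Implicit Types (e p y : 'rV[R]_n) (a eps delta : R).

(* The points whose hypersphere cuts or separates the (slightly shrunk) ball
   around [e] and the point [y]. *)
Definition cutting a delta (ey : 'rV[R]_n * 'rV[R]_n) : set 'rV[R]_n :=
  [set x | (dotp x ey.1 < sin a - delta \/ dotp x ey.2 < - delta) /\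
           (- dotp x ey.1 < sin a - delta \/ - dotp x ey.2 < - delta)].

Lemma borel_cutting a delta ey : borel (cutting a delta ey).
Proof.
have md e : measurable_fun [set: rVb R n] (fun x => dotp x e).
  exact: measurable_dotp.
have mN e : measurable_fun [set: rVb R n] (fun x => - dotp x e).
  by apply: measurableT_comp => //; exact: md.
apply: (@measurableI _ (rVb R n)); apply: (@measurableU _ (rVb R n));
  by apply: borel_lt => //.
Qed.

(** The band and the caps obtained from (e, y) and (-e, -y) are pairwise disjoint; two caps of 1/100
    each give the 1/50. *)
Lemma nsm_cutting a eps delta e y : 0 < a -> a < pi / 2 -> 0 < eps -> eps <= 1 ->
  sphere e -> sphere y -> - cos a <= dotp e y -> dotp e y <= cos (a + eps) ->
  a + eps <= pi -> 0 <= delta -> delta <= eps / 20 -> delta <= sin a ->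
  normalized_spherical_measure (band e (sin a - delta)) +
   eps * (a * (pi / 2 - a) * Num.sqrt eps / 100) ^+ k.+1 / 50 <=
  normalized_spherical_measure (cutting a delta (e, y)).
Proof.
move=> a0 ah e0 e1 se sy ey1 ey2 aepi d0 d1 d2.
have sN (z : 'rV[R]_n) : sphere z -> sphere (- z) by rewrite /sphere/= dotpNl dotpNr opprK.
have c1 := cap_measure a0 ah e0 e1 se sy ey1 ey2 aepi d0 d1.
have := cap_measure a0 ah e0 e1 (sN _ se) (sN _ sy); rewrite dotpNl dotpNr opprK.
move=> /(_ delta ey1 ey2 aepi d0 d1) c2.
set C1 := [set x | _] in c1; set C2 := [set x | _] in c2.
have bC (e' y' : 'rV[R]_n) : borel [set x : 'rV[R]_n | sin a <= dotp x e' /\ dotp x y' < - delta].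
  apply: (@measurableI _ (rVb R n) [set x : 'rV[R]_n | sin a <= dotp x e']).
    by apply: borel_le => //; exact: measurable_dotp.
  by apply: borel_lt => //; exact: measurable_dotp.
have bU : borel (C1 `|` C2) by apply: (@measurableU _ (rVb R n)); exact: bC.
have bB := borel_band e (sin a - delta).
have hp1 := @pihalf_ge1 R.
have sa0 : 0 < sin a by apply: sin_gt0_pi; clear -a0 ah hp1; lra.
apply: (@le_trans _ _ (normalized_spherical_measure
   (band e (sin a - delta) `|` (C1 `|` C2)))).
  rewrite !nsmU//; try exact: bC.
  - rewrite lerD2l; apply: le_trans (lerD c1 c2); move: (_ ^+ k.+1) => z.
    by clear; lra.
  - by move=> x _ [h1 _] [h2 _]; move: h2; rewrite dotpNr; clear -h1 sa0; lra.
  - move=> x _; rewrite /band/= ltr_norml => /andP[h1 h2] [[h3 _]|[h3 _]].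
      by clear -h2 h3 d0; lra.
    by move: h3; rewrite dotpNr; clear -h1 d0; lra.
apply: nsm_le; first exact: (@measurableU _ (rVb R n)).
  exact: borel_cutting.
move=> x [[xb|[[h1 h2]|[h1 h2]]] _]; rewrite /cutting/=.
- have /andP[h1 h2] : - (sin a - delta) < dotp x e < sin a - delta.
    by rewrite -ltr_norml; exact: xb.
  by split; left=> //; clear -h1; lra.
- by split; [right|left]; clear -h1 h2 d2 sa0 d0; lra.
- rewrite !dotpNr in h1 h2.
  by split; [left|right]; clear -h1 h2 d2 sa0 d0; lra.
Qed.

(* Pairs (incenter, distant vertex) that can occur for a cell contained in a
   hemisphere. *)
Definition far_pairs a eps : set ('rV[R]_n * 'rV[R]_n) :=
  (sphere `*` sphere) `&`
  [set ey | - cos a <= dotp ey.1 ey.2 <= cos (a + eps)].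

Lemma compact_far_pairs a eps : compact (far_pairs a eps).
Proof.
have cS : compact ((@sphere R n) `*` (@sphere R n)).
  by apply: compact_setX; exact: compact_sphere.
apply: (subclosed_compact _ cS); last by move=> z [].
apply: closedI.
  apply: closedI; apply: preimage_closed; try exact: closed_sphere.
    by move=> z _; exact: cvg_fst.
  by move=> z _; exact: cvg_snd.
rewrite (_ : [set ey | _] = (fun ey : 'rV[R]_n * 'rV[R]_n => dotp ey.1 ey.2) @^-1`
    `[- cos a, cos (a + eps)]%classic); last first.
  by apply/seteqP; split=> z /=; rewrite in_itv.
apply: preimage_closed; last exact: itv_closed.
move=> z _; apply: (@cvg_dotp _ _ _ (nbhs z) _ fst snd).
  exact: cvg_fst.
exact: cvg_snd.
Qed.

(** Balls are those of the sup norm: coordinates of a unit vector are at most 1 in absolute value,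
    so radius [delta] / n changes a dot product by at most [delta]. The centers stay in [far_pairs],
    where [nsm_cutting] applies. *)
Lemma far_pairs_net a eps delta : 0 < delta ->
  exists2 s : seq ('rV[R]_n * 'rV[R]_n), {subset s <= far_pairs a eps} &
   forall e y, far_pairs a eps (e, y) -> exists2 ey, ey \in s &
     forall x, sphere x -> `|dotp x e - dotp x ey.1| <= delta /\
                          `|dotp x y - dotp x ey.2| <= delta.
Proof.
move=> d0; pose r := delta / n%:R; have r0 : 0 < r by rewrite divr_gt0.
have : cover_compact (far_pairs a eps).
  pose V2 := HB.pack_for ptopologicalType ('rV[R]_n * 'rV[R]_n)%type.
  have cE : compact = @cover_compact V2 := compact_cover V2.
  by rewrite -[cover_compact _]/(@cover_compact V2 _) -cE; exact: compact_far_pairs.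
move=> /(_ _ (far_pairs a eps) (fun z => (ball z r)°)).
case=> [z _|z zS|D' D'sub cov]; first exact: open_interior.
  exists z => //; have := nbhs_interior (nbhsx_ballx z r r0).
  exact: nbhs_singleton.
exists (finmap.enum_fset D') => [z zD|e y eyS].
  exact: D'sub.
have [z /= zD /interior_subset [be by']] := cov _ eyS.
exists z => // x sx.
have bound (u v : 'rV[R]_n) : ball u r v -> `|dotp x v - dotp x u| <= delta.
  move=> [_ buv]; rewrite -dotpBr /dotp.
  rewrite (le_trans (ler_norm_sum _ _ _))//.
  apply: (@le_trans _ _ (\sum_(i < n) r)); last first.
    by rewrite sumr_const card_ord -[_ *+ n]mulr_natr divfK.
  apply: ler_sum => i _; rewrite normrM -[r]mul1r ler_pM//.
    exact: sphere_coord_le1.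
  rewrite !mxE; have := buv 0 i; rewrite -ball_normE/= distrC; exact: ltW.
by split; apply: bound.
Qed.

End Separation.

(** * Union bound over the net and conclusion *)

Lemma measure_union_bound d (T : measurableType d) (R : realType)
    (mu : {measure set T -> \bar R}) (I : eqType) (s : seq I) (A : I -> set T)
    (c : R) : (forall i, measurable (A i)) ->
  (forall i, i \in s -> (mu (A i) <= c%:E)%E) ->
  (mu [set w | exists2 i, i \in s & A i w] <= ((size s)%:R * c)%:E)%E /\
  measurable [set w | exists2 i, i \in s & A i w].
Proof.
move=> mA; elim: s => [|i s IH] hA.
  rewrite (_ : [set w | _] = set0) ?measure0 ?mul0r; last first.
    by apply/seteqP; split=> w // -[].
  by split.
have [|h1 h2] := IH; first by move=> j js; apply: hA; rewrite inE js orbT.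
rewrite (_ : [set w | _] = A i `|` [set w | exists2 i, i \in s & A i w]); last first.
  apply/seteqP; split=> w /=.
    by move=> [j]; rewrite inE => /predU1P[->|js] Aj; [left|right; exists j].
  by move=> [Ai|[j js Aj]]; [exists i; rewrite ?mem_head|exists j; rewrite ?inE ?js ?orbT].
split; last exact: measurableU.
rewrite (le_trans (measureU2 _ _ _))// /= -natr1 mulrDl mul1r addrC EFinD leeD//.
by apply: hA; rewrite mem_head.
Qed.

Lemma poisson_prob_set0 (R : realType) (rate : R) : 0 <= rate ->
  poisson_prob rate 0 [set 0%N] = (expR (- rate))%:E.
Proof.
rewrite le_eqVlt => /predU1P[<-|r0].
  (* At rate 0 [poisson_prob] is a Dirac mass, in accordance with exp 0 = 1. *)
  by rewrite /poisson_prob ltxx oppr0 expR0 diracE mem_set.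
rewrite /poisson_prob r0 esum_set1; last by rewrite lee_fin poisson_pmf_ge0.
by rewrite /poisson_pmf r0 expr0 fact0 invr1 !mul1r.
Qed.

Section Final.
Context {R : realType} {k : nat}.
Local Notation n := k.+3.
Implicit Types (p : 'rV[R]_n) (s : seq 'rV[R]_n).

(** The angles of [e] and [y] with [u] are at most pi/2 - a and pi/2, so [y] keeps distance a from
    the antipode of [e]. This is what confines the pairs to [far_pairs]. *)
Lemma cos_compl_bound (e y u : 'rV[R]_n) (a : R) : sphere e -> sphere y ->
  sphere u -> 0 < a < pi / 2 -> sin a <= dotp u e -> 0 <= dotp u y ->
  - cos a <= dotp e y.
Proof.
move=> se sy su /andP[a0 a1] ue uy; have hp1 := @pihalf_ge1 R.
have sa0 : 0 < sin a by apply: sin_gt0_pi; clear -a0 a1 hp1; lra.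
have ca0 : 0 <= cos a by apply: cos_ge0_pihalf; clear -a0 a1; lra.
have h := spherical_cos_rule se su sy; rewrite (dotpC e u) in h.
have h1 : (dotp e y - dotp u e * dotp u y) ^+ 2 <= cos a ^+ 2.
  apply: (le_trans h); rewrite -[X in _ <= X]mulr1 ler_pM//.
  - by have /andP[] := dotp_sphere_le1 su se; rewrite expr2; clear; nra.
  - by have /andP[] := dotp_sphere_le1 su sy; rewrite expr2; clear; nra.
  - rewrite cos2sin2 lerD2l lerN2 ler_pXn2r// ?nnegrE ?ltW//.
    exact: lt_le_trans ue.
  - by rewrite gerBl sqr_ge0.
have h2 : 0 <= dotp u e * dotp u y.
  by rewrite mulr_ge0// ltW// (lt_le_trans sa0).
have h3 : - cos a <= dotp e y - dotp u e * dotp u y.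
  rewrite leNgt; apply/negP => h3; move: h1; rewrite leNgt => /negP; apply.
  by rewrite !expr2; clear -h3 ca0; nra.
by clear -h2 h3; lra.
Qed.

Lemma deep_cell_not_cut p s a eps delta (net : seq ('rV[R]_n * 'rV[R]_n)) :
  sphere p -> (forall x, x \in s -> sphere x) ->
  0 < a < pi / 2 -> 0 < eps <= 1 ->
  (forall e y, far_pairs a eps (e, y) -> exists2 ey, ey \in net &
     forall x, sphere x -> `|dotp x e - dotp x ey.1| <= delta /\
                          `|dotp x y - dotp x ey.2| <= delta) ->
  deep_cell p s a eps ->
  exists2 ey, ey \in net & forall x, x \in s -> ~ cutting a delta ey x.
Proof.
move=> sp ss a01 eps01 hnet /(deep_cellP sp ss a01 eps01)[op s0 ma].
move=> [[e y] [/= se sy]]; rewrite /far_pair !le_min/= !subr_ge0.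
move=> /andP[/andP[me my] ey].
have hp1 := @pihalf_ge1 R; have [a0 a1] := andP a01; have [e0 e1] := andP eps01.
have sa0 : 0 < sin a by apply: sin_gt0_pi; clear -a0 a1 hp1; lra.
have M1 : max_margin p s <= 1 by have [z _ <-] := max_marginP p s; exact: margin_le1.
have su x : x \in s -> sphere (Num.sg (dotp x p) *: x).
  by move=> xX; rewrite /sphere/= !dotpE (ss x xX) mulr1 -expr2 sqr_sg op.
have he x : x \in s -> sin a <= Num.sg (dotp x p) * dotp x e.
  by move=> xs; rewrite (le_trans ma)// (le_trans me)// margin_le.
have hy x : x \in s -> 0 <= Num.sg (dotp x p) * dotp x y.
  by move=> xs; rewrite (le_trans my)// margin_le.
have fp : far_pairs a eps (e, y).
  split=> //=; apply/andP; split.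
    (* Any point of the configuration provides the hemisphere. *)
    have [x xs] : exists x, x \in s.
      by clear -s0; case: s s0 => [//|x s] _; exists x; exact: mem_head.
    by apply: (cos_compl_bound se sy (su x xs) a01); rewrite dotpZl ?he ?hy.
  apply: (le_trans ey); rewrite far_boundE; last by rewrite M1 andbT; clear -sa0 ma; lra.
  have aM : a <= asin (max_margin p s).
    rewrite -{1}[a](@sinK R); last by rewrite in_itv/=; clear -a0 a1 hp1; lra.
    by apply: le_asin => //; exact: sin_geN1.
  have : asin (max_margin p s) <= pi / 2.
    by rewrite asin_lepi2// M1 andbT; clear -sa0 ma; lra.
  move: (asin _) aM => t aM tp; rewrite leNgt; apply/negP.
  rewrite ltr_cos ?in_itv/=; last 2 first.
  - by clear -aM tp a0 e0 e1 hp1; lra.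
  - by clear -aM tp a0 e0 e1 hp1; lra.
  by clear -aM; lra.
have [ey' eyn hxy] := hnet e y fp; exists ey' => // x xs.
have [] := hxy x (ss x xs); rewrite !ler_norml => /andP[h1 h2] /andP[h3 h4].
have := he x xs; have := hy x xs; rewrite /cutting/=.
(* The side of [p] decides which of the two disjunctions in [cutting] fails; replacing the pair by
   its net point costs [delta] in each dot product, the slack built into [cutting]. *)
case: sgrP (op x xs) => // _ _; rewrite ?mul1r ?mulN1r => h5 h6 [] [] h7 [] h8.
all: clear -h1 h2 h3 h4 h5 h6 h7 h8; lra.
Qed.

End Final.

Theorem theorem6p5 (R : realType) (d : nat) (a eps : R) :
  (2 <= d)%N -> 0 < a < pi / 2 -> 0 < eps <= 1 ->
  exists c6 c7 : R,
    [/\ 0 < c6, 0 < c7,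
        3 / 10 * (1 / 100) ^+ d * a ^+ (d - 1) * (pi / 2 - a) ^+ (d - 1) <= c7 &
        forall (gamma : R) (p : 'rV[R]_d.+1) (disp : measure_display)
               (T : measurableType disp) (P : probability T R)
               (X : T -> seq 'rV[R]_d.+1),
          0 < gamma -> sphere p -> isotropic_poisson_process P gamma X ->
          cond_prob P
            [set w | spherically_convex_body (crofton_cell p (X w)) /\
                     (eps%:E <= vartheta_r (crofton_cell p (X w)))%E]
            [set w | (a%:E <= inradius (crofton_cell p (X w)))%E]
          <= c6 * expR (- c7 * eps `^ (d.+1%:R / 2) * gamma)].
Proof.
(* From here d = k + 2: the ambient dimension is k + 3 and the exponent d - 1 is k + 1. *)
case: d => [//|[//|k]] _ a01 eps01; have [a0 a1] := andP a01; have [e0 e1] := andP eps01.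
have hp1 := @pihalf_ge1 R.
have b0 : 0 < pi / 2 - a by rewrite subr_gt0.
have sa0 : 0 < sin a by apply: sin_gt0_pi; clear -a0 a1 hp1; lra.
pose r := a * (pi / 2 - a) * Num.sqrt eps / 100.
have r0 : 0 < r by rewrite divr_gt0// !mulr_gt0// sqrtr_gt0.
pose c7 : R := 3 / 10 * (1 / 100) ^+ k.+2 * a ^+ (k.+2 - 1) * (pi / 2 - a) ^+ (k.+2 - 1).
have c7E : c7 * eps `^ (k.+3%:R / 2) = 3 / 1000 * (eps * r ^+ k.+1).
  rewrite (_ : k.+3%:R / 2 = 1 + 2^-1 * k.+1%:R); last first.
    by rewrite -[k.+3]/(2 + k.+1)%N natrD; field.
  rewrite powRD ?gt_eqF ?implybT// powRr1 ?ltW// powRrM powR12_sqrt ?ltW//.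
  rewrite powR_mulrn ?sqrtr_ge0// /c7 subn1/= /r !exprMn expr1n (exprS _ k.+1).
  move: (_ ^+ k.+1) (a ^+ k.+1) (_ ^+ k.+1) (_ ^+ k.+1) => z1 z2 z3 z4.
  by field.
have hc7 : 0 < c7.
  apply: mulr_gt0; last exact: exprn_gt0.
  apply: mulr_gt0; last exact: exprn_gt0.
  by apply: mulr_gt0; [|apply: exprn_gt0]; clear; lra.
(* The 1/50 of [nsm_cutting] is 17/1000 + 3/1000: the first part pays for shrinking the band, the
   second is the rate in [c7E]. *)
pose eta := 17 / 1000 * (eps * r ^+ k.+1).
have eta0 : 0 < eta.
  apply: mulr_gt0; last by apply: mulr_gt0 => //; exact: exprn_gt0.
  by clear; lra.
(* An auxiliary center, since [delta] and the net must be fixed before [p] is given; [nsm_band]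
   transfers the measure to [p] and to the net points. *)
have [e00 se00] := @sphere_nonempty R k.+1.
have [delta1 d10 hdelta1] := nsm_band_left_continuous e00 (sin a) eta0.
pose delta := Num.min delta1 (Num.min (eps / 20) (sin a)).
have dpos : 0 < delta by rewrite !lt_min d10 sa0 andbT/=; clear -e0; lra.
have dle1 : delta <= delta1 by rewrite ge_min lexx.
have dle2 : delta <= eps / 20 by rewrite !ge_min lexx orbT.
have dle3 : delta <= sin a by rewrite !ge_min lexx !orbT.
have [net netS hnet] := @far_pairs_net R k a eps delta dpos.
(* The successor keeps the constant positive even for an empty net. *)
exists (size net).+1%:R, c7; split=> // gamma p disp T P X g0 sp [sX mX PX _].
pose Phi := normalized_spherical_measure (band p (sin a)).
have Pnone A : borel A -> P [set w | forall x, x \in X w -> ~ A x] =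
    (expR (- (gamma * normalized_spherical_measure A)))%:E.
  move=> bA; rewrite -num_points_eq0 PX// poisson_prob_set0//.
  by apply: mulr_ge0; [exact: ltW|exact: nsm_ge0].
have mnone A : borel A -> measurable [set w | forall x, x \in X w -> ~ A x].
  move=> bA; apply: measurable_forall_points => //.
  exact: (@measurableC _ (rVb R k.+3)).
have mB := measurable_inradius_event mX sX sp a01.
have mAB := measurable_deep_cell mX sX sp a01 eps01.
set B := [set w | (a%:E <= _)%E] in mB *.
have PB : expR (- (gamma * Phi)) <= fine (P B).
  rewrite -lee_fin fineK; last exact: fin_num_measure.
  rewrite -Pnone; last exact: borel_band.
  apply: le_measure; [apply/mem_set|exact/mem_set|].
    by apply: mnone; exact: borel_band.
  (* When no hypersphere meets the ball, [p] itself has margin at least sin a. *)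
  move=> w /= h; apply/(inradius_eventP sp (sX w) a01).
  have hx x : x \in X w -> sin a <= `|dotp x p|.
    by move=> xX; rewrite leNgt; apply/negP; exact: h.
  split; first by move=> x xX; rewrite -normr_gt0 (lt_le_trans sa0)// hx.
  apply: le_trans (le_max_margin _ _ sp); apply/margin_geP; split.
    exact: sin_le1.
  by move=> x xX; rewrite -normrEsg hx.
have hcut ey : ey \in net ->
    Phi + c7 * eps `^ (k.+3%:R / 2) <= normalized_spherical_measure (cutting a delta ey).
  move=> /netS /set_mem; case: ey => e y [[/= se sy] /andP[ey1 ey2]].
  have aepi : a + eps <= pi by clear -a1 e1 hp1; lra.
  apply: le_trans (nsm_cutting a0 a1 e0 e1 se sy ey1 ey2 aepi (ltW dpos) dle2 dle3).
  rewrite (nsm_band _ se se00) -/r c7E /Phi (nsm_band _ sp se00).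
  have := hdelta1 delta; rewrite (ltW dpos) dle1 => /(_ isT); rewrite /eta.
  move: (normalized_spherical_measure _) (normalized_spherical_measure _) => x1 x2.
  by move: (r ^+ k.+1) => z; clear; lra.
have Pcut ey : ey \in net ->
    (P [set w | forall x, x \in X w -> ~ cutting a delta ey x] <=
     (expR (- (gamma * (Phi + c7 * eps `^ (k.+3%:R / 2)))))%:E)%E.
  move=> eyn; rewrite Pnone; last exact: borel_cutting.
  by rewrite lee_fin ler_expR lerN2 ler_pM2l// hcut.
have [Pnet mnet] := @measure_union_bound _ T R P _ net
  (fun ey => [set w | forall x, x \in X w -> ~ cutting a delta ey x])
  (expR (- (gamma * (Phi + c7 * eps `^ (k.+3%:R / 2)))))
  (fun ey => mnone _ (borel_cutting a delta ey)) Pcut.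
have PAB : fine (P [set w | deep_cell p (X w) a eps]) <=
    (size net)%:R * expR (- (gamma * (Phi + c7 * eps `^ (k.+3%:R / 2)))).
  rewrite -lee_fin fineK; last exact: fin_num_measure.
  apply: le_trans Pnet; apply: le_measure; [exact/mem_set|exact/mem_set|move=> w].
exact: (deep_cell_not_cut sp (sX w) a01 eps01).
have PB0 : 0 < fine (P B) by apply: lt_le_trans PB; exact: expR_gt0.
rewrite /cond_prob ler_pdivrMr//. apply: (le_trans PAB).
(* The factor exp (- gamma * Phi) split off here is absorbed by the lower bound [PB] of the
   denominator. *)
apply: (@le_trans _ _ ((size net).+1%:R * expR (- c7 * eps `^ (k.+3%:R / 2) * gamma)
   * expR (- (gamma * Phi)))); last first.
  by rewrite ler_wpM2l// mulr_ge0 ?expR_ge0.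
rewrite -mulrA -expRD (_ : - c7 * _ * gamma + _ =
   - (gamma * (Phi + c7 * eps `^ (k.+3%:R / 2)))); last by ring.
by rewrite ler_wpM2r ?expR_ge0// ler_nat.
Qed.
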